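(* There is an algorithm that, given the set $T$ of connected triples of a connected triangle-free graph $G$ on $n\geq 5$ vertices (and the knowledge that $G$ is triangle-free), reconstructs $G$ in deterministic $O(|T|\log |T|)$ time, or in randomized $O(|T|)$ expected time.
   Context: All graphs are finite, simple and connected. For a graph $G$, a connected triple is a $3$-element subset $\{a,b,c\}\subseteq V(G)$ such that $G[\{a,b,c\}]$ is connected. Reconstructing $G$ means outputting its (labelled) edge set. *)

(* Defs.v *)
From HB Require Import structures.
From mathcomp Require Import all_boot all_order all_algebra.

Set Implicit Arguments.
Unset Strict Implicit.
Unset Printing Implicit Defensive.

Record sgraph := SGraph {
  vertex :> finType;
  adj : rel vertex;
  adj_sym : symmetric adj;
  adj_irr : irreflexive adj }.

Section Graphs.
Variable G : sgraph.
Implicit Types (A : {set G}).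

Definition induced_adj A : rel G :=
  [rel x y | [&& x \in A, y \in A & adj x y]].

Definition induced_connected A : bool :=
  [forall x in A, forall y in A, connect (induced_adj A) x y].

Definition connected_graph : bool := induced_connected [set: G].

Definition triangle_free : Prop :=
  forall x y z : G, ~~ [&& adj x y, adj y z & adj z x].

Definition connected_triples : {set {set G}} :=
  [set A : {set G} | (#|A| == 3) && induced_connected A].

Definition edge_set : {set {set G}} :=
  [set [set p.1; p.2] | p : G * G & adj p.1 p.2].

(* The sequences below list every member of the set exactly once; the order of
   the list, and of the vertices inside each member, is arbitrary. *)
Definition lists_triples (ts : seq (G * G * G)) : bool :=
  perm_eq [seq [set t.1.1; t.1.2; t.2] | t <- ts] (enum connected_triples).

Definition lists_edges (es : seq (G * G)) : bool :=
  perm_eq [seq [set e.1; e.2] | e <- es] (enum edge_set).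

End Graphs.

(* Word RAM with unit-cost instructions.  A machine with word size w has words
   0, ..., 2 ^ w - 1, which serve both as values and as memory addresses.
   Programs do not depend on w.  Register and jump-target indices are part of
   the program text. *)

Variant binop := Add | Sub | Mul | Div | Mod | Shl | Shr | Lt | Eq.

Variant instr :=
  | Const of nat & nat            (* r_d := k           *)
  | Op of binop & nat & nat & nat (* r_d := r_a op r_b  *)
  | Read of nat & nat             (* r_d := mem[r_a]    *)
  | Write of nat & nat            (* mem[r_a] := r_b    *)
  | Jump of nat
  | Jumpz of nat & nat            (* if r_a = 0 goto l  *)
  | Rand of nat                   (* r_d := uniformly random word *)
  | Halt.

Definition program := seq instr.

Definition deterministic (P : program) : bool :=
  all (fun i => if i is Rand _ then false else true) P.

Record state := State { pc : nat; reg : nat -> nat; memory : nat -> nat }.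

Section Machine.
Variables (w : nat) (P : program).

(* Division by zero yields 0, and a mod 0 = a. *)
Definition eval_op (o : binop) (a b : nat) : nat :=
  match o with
  | Add => (a + b) %% 2 ^ w
  | Sub => (a + (2 ^ w - b)) %% 2 ^ w
  | Mul => (a * b) %% 2 ^ w
  | Div => a %/ b
  | Mod => a %% b
  | Shl => (a * 2 ^ b) %% 2 ^ w
  | Shr => a %/ 2 ^ b
  | Lt => a < b
  | Eq => a == b
  end.

Definition fetch (s : state) : instr := nth Halt P (pc s).

Definition halted (s : state) : bool := if fetch s is Halt then true else false.

Definition upd (f : nat -> nat) (i v : nat) : nat -> nat :=
  fun j => if j == i then v else f j.

Definition step (rnd : nat) (s : state) : state :=
  let: State p r m := s in
  match fetch s with
  | Const d k => State p.+1 (upd r d (k %% 2 ^ w)) m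
  | Op o d a b => State p.+1 (upd r d (eval_op o (r a) (r b))) m
  | Read d a => State p.+1 (upd r d (m (r a))) m
  | Write a b => State p.+1 r (upd m (r a) (r b))
  | Jump l => State l r m
  | Jumpz a l => State (if r a == 0 then l else p.+1) r m
  | Rand d => State p.+1 (upd r d rnd) m
  | Halt => s
  end.

(* The word [tape k] is available during step k only, so that independent
   uniform tape entries make each execution of [Rand] return a fresh
   independent uniform word. *)
Fixpoint run (tape : nat -> nat) (s : state) (k : nat) : state :=
  if k is k'.+1 then step (tape k') (run tape s k') else s.

(* min (running time) K *)
Definition time_upto (tape : nat -> nat) (s : state) (K : nat) : nat :=
  \sum_(k < K) ~~ halted (run tape s k).

(* The expectation of min (running time) K; it only depends on the first K
   tape entries. *)
Definition mean_time_upto (s : state) (K : nat) : rat :=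
  ((\sum_(u : K.-tuple 'I_(2 ^ w))
      (time_upto (fun i => nth 0%N (map val u) i) s K)%:R)
   / ((2 ^ w) ^ K)%N%:R)%R.

(* By monotone convergence, the expected running time is the supremum over K
   of the truncated expectations; in particular it is infinite when the
   program fails to halt with positive probability. *)
Definition expected_time_le (s : state) (B : nat) : Prop :=
  forall K : nat, (mean_time_upto s K <= B%:R)%R.

End Machine.

Section InputOutput.
Variables (w : nat) (G : sgraph) (label : G -> 'I_(2 ^ w)).

Definition triples_words (ts : seq (G * G * G)) : seq nat :=
  size ts :: flatten [seq [:: val (label t.1.1); val (label t.1.2); val (label t.2)]
                     | t <- ts].

Definition edges_words (es : seq (G * G)) : seq nat :=
  size es :: flatten [seq [:: val (label e.1); val (label e.2)] | e <- es].

Definition init_state (ts : seq (G * G * G)) : state :=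
  State 0 (fun=> 0) (fun i => nth 0 (triples_words ts) i).

Definition outputs_edges (s : state) : Prop :=
  exists2 es : seq (G * G), lists_edges es &
    forall i, i < size (edges_words es) -> memory s i = nth 0 (edges_words es) i.

End InputOutput.

(* Main.v *)
From mathcomp Require Import all_boot all_order all_algebra.
From mathcomp Require Import zify.
Require Import Defs.

(**
  In a triangle-free graph, a connected triple is a path [u - b - a].  Write
  [s u v] for the number of connected triples that contain [u] and [v], and
  [t v] for the number of those that contain [v].  If [u] and [v] are adjacent
  then [s u v = deg u + deg v - 2], otherwise [s u v] is their number of common
  neighbours.  Hence [s u a <= deg u <= s u b] for a path [u - b - a], with
  equality only if [deg b = 2] and [N(u)] is contained in [N(a)]; in this case
  [t b < t a], by counting if [deg a >= 3], and otherwise because some edge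
  leaves the set [{u, a, b} ∪ N(a)], which has at most 4 vertices.  So the
  centre of a triple is its vertex for which ([s] of the two others, [t] of the
  vertex) is lexicographically minimal.

  All these counts are computed in time linear in the number of triples,
  without sorting or hashing: memory is initially zero and has [2 ^ w] cells,
  so a vertex label can be used as an address once labels are split by parity
  and halved.  The same deterministic program proves both claims.
*)

Set Implicit Arguments.
Unset Strict Implicit.
Unset Printing Implicit Defensive.

(** * A structured language and its compilation *)

Inductive expr :=
  | Var of nat
  | Num of nat
  | Bin of binop & expr & expr
  | Deref of expr.

Variant stmt := Assign of nat & expr | Store of expr & expr.

(* [Loop i n body] is [while r_i < r_n do body]. *)
Variant cmd := Do of stmt | Loop of nat & nat & seq stmt.

(* Registers below [nvars] hold variables; the others are scratch space for
   the evaluation of expressions. *)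
Definition nvars := 24.

(** There is no move instruction. Shifting right by zero copies a register exactly, whereas adding
    zero would reduce it modulo [2 ^ w]. *)
Fixpoint compile_expr (k : nat) (e : expr) : seq instr :=
  match e with
  | Var v => [:: Const k 0; Op Shr k v k]
  | Num n => [:: Const k n]
  | Bin o a b => compile_expr k a ++ compile_expr k.+1 b ++ [:: Op o k k k.+1]
  | Deref a => compile_expr k a ++ [:: Read k k]
  end.

Definition compile_stmt (c : stmt) : seq instr :=
  match c with
  | Assign v e =>
      compile_expr nvars e ++ [:: Const nvars.+1 0; Op Shr v nvars nvars.+1]
  | Store a e =>
      compile_expr nvars a ++ compile_expr nvars.+1 e ++ [:: Write nvars nvars.+1]
  end.

Definition compile_body (b : seq stmt) : seq instr := flatten (map compile_stmt b).

Definition compile_cmd (l : nat) (c : cmd) : seq instr :=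
  match c with
  | Do s => compile_stmt s
  | Loop i n b =>
      let code := compile_body b in
      [:: Op Lt nvars i n; Jumpz nvars (l + size code + 3)] ++ code ++ [:: Jump l]
  end.

Fixpoint compile (l : nat) (cs : seq cmd) : seq instr :=
  if cs is c :: cs' then
    let code := compile_cmd l c in code ++ compile (l + size code) cs'
  else [::].

Fixpoint wf_expr (e : expr) : bool :=
  match e with
  | Var v => v < nvars
  | Num _ => true
  | Bin _ a b => wf_expr a && wf_expr b
  | Deref a => wf_expr a
  end.

Definition wf_stmt (c : stmt) : bool :=
  match c with
  | Assign v e => (v < nvars) && wf_expr e
  | Store a e => wf_expr a && wf_expr e
  end.

Definition straight (i : instr) : bool :=
  match i with Jump _ | Jumpz _ _ | Rand _ | Halt => false | _ => true end.

(** * Semantics of straight-line code *)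

Section Execution.
Variable w : nat.
Implicit Types (P c : program) (r : nat -> nat) (m : nat -> nat).

Definition exec1 (i : instr) (rm : (nat -> nat) * (nat -> nat)) :=
  let: (r, m) := rm in
  match i with
  | Const d k => (upd r d (k %% 2 ^ w), m)
  | Op o d a b => (upd r d (eval_op w o (r a) (r b)), m)
  | Read d a => (upd r d (m (r a)), m)
  | Write a b => (r, upd m (r a) (r b))
  | _ => (r, m)
  end.

Definition exec c rm := foldl (fun rm i => exec1 i rm) rm c.

Lemma exec_cat c1 c2 rm : exec (c1 ++ c2) rm = exec c2 (exec c1 rm).
Proof. exact: foldl_cat. Qed.

(** The random words are fixed to 0; by [run_steps] this is harmless for deterministic programs. *)
Definition steps P k s := iter k (step w P 0) s.

Lemma steps_add P j k s : steps P (j + k) s = steps P k (steps P j s).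
Proof. by rewrite /steps addnC iterD. Qed.

Lemma steps_straight P pre c post r m :
  P = pre ++ c ++ post -> all straight c ->
  steps P (size c) (State (size pre) r m) =
  State (size pre + size c) (exec c (r, m)).1 (exec c (r, m)).2.
Proof.
elim: c pre r m => [|i c IH] pre r m defP; first by rewrite addn0.
move=> /andP[si sc]; rewrite -[size _]add1n steps_add.
have -> : steps P 1 (State (size pre) r m) =
    State (size pre).+1 (exec1 i (r, m)).1 (exec1 i (r, m)).2.
  have fi : nth Halt P (size pre) = i by rewrite defP nth_cat ltnn subnn.
  by rewrite /steps /= /step /fetch /= fi; case: i si {fi defP}.
have := IH (rcons pre i) (exec1 i (r, m)).1 (exec1 i (r, m)).2.
rewrite -surjective_pairing size_rcons addSnnS; apply=> //.
by rewrite defP -cats1 -catA.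
Qed.

Fixpoint eval r m (e : expr) : nat :=
  match e with
  | Var v => r v
  | Num n => n %% 2 ^ w
  | Bin o a b => eval_op w o (eval r m a) (eval r m b)
  | Deref a => m (eval r m a)
  end.

Lemma straight_expr k e : all straight (compile_expr k e).
Proof.
by elim: e k => [v|n|o a IHa b IHb|a IHa] k //=; rewrite !all_cat ?IHa ?IHb.
Qed.

Lemma straight_stmt (c : stmt) : all straight (compile_stmt c).
Proof. by case: c => [v e|a e] /=; rewrite !all_cat !straight_expr. Qed.

Lemma straight_body b : all straight (compile_body b).
Proof. by elim: b => //= c b IH; rewrite all_cat straight_stmt. Qed.

(** Compiled code overwrites scratch registers, so machine and source registers are compared on
    variables only. *)
Definition agree r r' := forall j, j < nvars -> r j = r' j.

Lemma eval_agree r r' m e : wf_expr e -> agree r r' -> eval r m e = eval r' m e.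
Proof.
move=> we ag; elim: e we => [v|n|o a IHa b IHb|a IHa] //=; first exact: ag.
- by case/andP=> /IHa -> /IHb ->.
- by move/IHa ->.
Qed.

(** The registers from [k] on act as an evaluation stack: the first operand stays safe in [k] while
    the second is evaluated from [k.+1] on. *)
Lemma exec_expr k e r m : wf_expr e -> nvars <= k ->
  exists r', [/\ exec (compile_expr k e) (r, m) = (r', m),
    r' k = eval r m e & forall j, j < k -> r' j = r j].
Proof.
elim: e k r => [v|n|o a IHa b IHb|a IHa] k r /=.
- move=> vn nk; eexists; split; first by [].
    by rewrite /upd eqxx ifF ?eqxx ?mod0n ?divn1 // ltn_eqF // (leq_trans vn).
  by move=> j jk; rewrite /upd !ifF // ltn_eqF.
- move=> _ nk; eexists; split; first by [].
    by rewrite /upd eqxx.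
  by move=> j jk; rewrite /upd !ifF // ltn_eqF.
- case/andP=> wa wb nk; rewrite !exec_cat.
  have [r1 [-> v1 e1]] := IHa k r wa nk.
  have [r2 [-> v2 e2]] := IHb k.+1 r1 wb (leqW nk).
  eexists; split; first by [].
    rewrite /upd eqxx v2 e2 // v1 (@eval_agree r1 r) // => j jn.
    by rewrite e1 // (leq_trans jn).
  by move=> j jk; rewrite /upd ifF ?ltn_eqF // e2 ?e1 // ltnW.
- move=> wa nk; rewrite !exec_cat.
  have [r1 [-> v1 e1]] := IHa k r wa nk.
  eexists; split; first by [].
    by rewrite /upd eqxx v1.
  by move=> j jk; rewrite /upd ifF ?ltn_eqF // e1.
Qed.

Definition exec_stmt (c : stmt) r m :=
  match c with
  | Assign v e => (upd r v (eval r m e), m)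
  | Store a e => (r, upd m (eval r m a) (eval r m e))
  end.

Lemma exec_stmt_correct (c : stmt) r r' m : wf_stmt c -> agree r r' ->
  exists r2, exec (compile_stmt c) (r', m) = (r2, (exec_stmt c r m).2)
    /\ agree (exec_stmt c r m).1 r2.
Proof.
case: c => [v e|a e] /= /andP[w1 w2] ag.
  rewrite exec_cat; have [r1 [-> v1 e1]] := exec_expr r' m w2 (leqnn nvars).
  eexists; split; first by [].
  move=> j jn; rewrite /upd; case: eqP => [_|_].
    by rewrite /= mod0n divn1 v1 (eval_agree _ w2 ag).
  by rewrite (ltn_eqF (leqW jn)) e1 ?ag.
rewrite !exec_cat; have [r1 [-> v1 e1]] := exec_expr r' m w1 (leqnn nvars).
have [r2 [-> v2 e2]] := exec_expr r1 m w2 (leqnSn nvars).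
eexists; split.
  rewrite /= v2 e2 // v1 (eval_agree _ w1 ag) (@eval_agree r r1) //.
  by move=> j jn; rewrite e1 // ag.
by move=> j jn; rewrite e2 ?e1 ?ag // ltnW.
Qed.

(** * Weakest preconditions and timed Hoare triples *)

Definition op_ok (o : binop) (a b : nat) : Prop :=
  match o with
  | Add => a + b < 2 ^ w
  | Sub => b <= a < 2 ^ w
  | Mul => a * b < 2 ^ w
  | Shl | Shr => False
  | _ => True
  end.

(** Shifts serve only for compiled register copies; [op_ok] excludes them from source expressions,
    so their value here is a dummy. *)
Definition op_val (o : binop) (a b : nat) : nat :=
  match o with
  | Add => a + b
  | Sub => a - b
  | Mul => a * b
  | Div => a %/ b
  | Mod => a %% b
  | Lt => a < b
  | Eq => a == b
  | Shl | Shr => 0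
  end.

Lemma eval_op_val o a b : op_ok o a b -> eval_op w o a b = op_val o a b.
Proof.
case: o => //= h; try by rewrite modn_small.
case/andP: h => ba aw; have -> : a + (2 ^ w - b) = a - b + 2 ^ w by lia.
by rewrite modnDr modn_small //; lia.
Qed.

(** In continuation style, each no-overflow condition appears where its operation is evaluated, with
    both operands known. *)
Fixpoint wp_expr r m (e : expr) (Q : nat -> Prop) : Prop :=
  match e with
  | Var v => Q (r v)
  | Num n => n < 2 ^ w /\ Q n
  | Bin o a b => wp_expr r m a (fun x => wp_expr r m b (fun y =>
      op_ok o x y /\ Q (op_val o x y)))
  | Deref a => wp_expr r m a (fun x => Q (m x))
  end.

Lemma wp_exprP r m e (Q : nat -> Prop) : wp_expr r m e Q -> Q (eval r m e).
Proof.
elim: e Q => [v|n|o a IHa b IHb|a IHa] Q //=.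
- by case=> nw; rewrite modn_small.
- by move/IHa/IHb=> [/eval_op_val ->].
- by move/IHa.
Qed.

Definition assertion := (nat -> nat) -> (nat -> nat) -> Prop.

(** The equations [y = x] and [m' = upd m x y] give each new value a name, so that goals do not grow
    by substitution. *)
Fixpoint wp (b : seq stmt) (Q : assertion) r m : Prop :=
  match b with
  | [::] => Q r m
  | Assign v e :: b' =>
      wp_expr r m e (fun x => forall y, y = x -> wp b' Q (upd r v y) m)
  | Store a e :: b' =>
      wp_expr r m a (fun x => wp_expr r m e (fun y =>
        forall m', m' = upd m x y -> wp b' Q r m'))
  end.

Lemma exec_body_correct b (Q : assertion) r r' m :
  all wf_stmt b -> agree r r' -> wp b Q r m ->
  exists r2 r2' m2, [/\ exec (compile_body b) (r', m) = (r2', m2),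
    agree r2 r2' & Q r2 m2].
Proof.
elim: b r r' m => [|c b IH] r r' m /=; first by move=> _ ag q; exists r, r', m.
case/andP=> wc wb ag wpb; rewrite exec_cat.
have [r1 [-> ag1]] := exec_stmt_correct m wc ag.
apply: IH ag1 _ => //; case: c {wc} wpb => [v e|a e] /=.
  by move/wp_exprP/(_ _ erefl).
by move/wp_exprP/wp_exprP/(_ _ erefl).
Qed.

(** Jump targets are absolute, so the code is compiled for its actual position inside an arbitrary
    program. Assertions speak of the source registers [r]; [r'] are those of the machine. *)
Definition triple (Pre : assertion) (cs : seq cmd) (t : nat) (Post : assertion) :=
  forall P pre post r r' m,
    P = pre ++ compile (size pre) cs ++ post -> agree r r' -> Pre r m ->
    exists k r2 r2' m2, [/\ k <= t,
      steps P k (State (size pre) r' m)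
        = State (size pre + size (compile (size pre) cs)) r2' m2,
      agree r2 r2' & Post r2 m2].

Lemma triple_cat (A B C : assertion) cs1 cs2 t1 t2 :
  triple A cs1 t1 B -> triple B cs2 t2 C -> triple A (cs1 ++ cs2) (t1 + t2) C.
Proof.
have compile_cat l ds1 ds2 : compile l (ds1 ++ ds2) =
    compile l ds1 ++ compile (l + size (compile l ds1)) ds2.
  elim: ds1 l => [|d ds1 IH] l /=; first by rewrite addn0.
  by rewrite IH catA size_cat addnA.
move=> h1 h2 P pre post r r' m defP ag a.
rewrite compile_cat -catA in defP.
have [k1 [r1 [r1' [m1 [k1t s1 ag1 b1]]]]] := h1 P pre _ r r' m defP ag a.
rewrite catA -size_cat in defP.
have [k2 [r2 [r2' [m2 [k2t s2 ag2 c2]]]]] := h2 P _ post r1 r1' m1 defP ag1 b1.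
exists (k1 + k2), r2, r2', m2; split=> //; first exact: leq_add.
by rewrite steps_add s1 -size_cat s2 compile_cat !size_cat !addnA.
Qed.

Lemma triple_do (A B : assertion) b :
  all wf_stmt b -> (forall r m, A r m -> wp b B r m) ->
  triple A (map Do b) (size (compile_body b)) B.
Proof.
have compile_do l b' : compile l (map Do b') = compile_body b'.
  by elim: b' l => //= c b' IH l; rewrite IH.
move=> wb h P pre post r r' m; rewrite compile_do => defP ag a.
have [r2 [r2' [m2 [e ag2 q]]]] := exec_body_correct wb ag (h r m a).
exists (size (compile_body b)), r2, r2', m2; split=> //.
by rewrite (steps_straight _ _ defP (straight_body _)) e.
Qed.

(** An iteration costs its body plus three instructions: comparison, conditional jump and jump back.
    The final failing test costs two. *)
Lemma triple_loop (I : nat -> assertion) i n N b :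
  i < nvars -> n < nvars -> all wf_stmt b ->
  (forall j r m, I j r m -> r i = j /\ r n = N) ->
  (forall j r m, j < N -> I j r m -> wp b (I j.+1) r m) ->
  triple (I 0) [:: Loop i n b] (N * (size (compile_body b) + 3) + 2) (I N).
Proof.
move=> vi vn wb hin hb P pre post r r' m; rewrite /= !cats0.
set code := compile_body b; set pc0 := size pre => defP ag a0.
have f0 : nth Halt P pc0 = Op Lt nvars i n.
  by rewrite defP nth_cat ltnn subnn.
have f1 : nth Halt P pc0.+1 = Jumpz nvars (pc0 + size code + 3).
  by rewrite defP nth_cat ltnNge leqnSn /= subSnn.
have f2 : nth Halt P (pc0 + 2 + size code) = Jump pc0.
  rewrite defP nth_cat ltnNge -addnA leq_addr /= addKn /= nth_cat size_cat /=.
  by rewrite addn1 leqnn nth_cat ltnn subnn.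
(* Induction on the number [d] of remaining iterations. *)
suff main d j r1 r1' m1 : j + d = N -> agree r1 r1' -> I j r1 m1 ->
    exists k r2 r2' m2, [/\ k <= d * (size code + 3) + 2,
      steps P k (State pc0 r1' m1) = State (pc0 + size code + 3) r2' m2,
      agree r2 r2' & I N r2 m2].
  have [k [r2 [r2' [m2 [kt s2 ag2 q2]]]]] := main N 0 r r' m erefl ag a0.
  exists k, r2, r2', m2; split=> //; rewrite s2 size_cat /= /pc0.
  by congr State; lia.
have two q q' qm : agree q q' -> steps P 2 (State pc0 q' qm) =
    State (if q i < q n then pc0.+2 else pc0 + size code + 3)
      (upd q' nvars (q i < q n)) qm.
  move=> agq; have s1 : step w P 0 (State pc0 q' qm) =
      State pc0.+1 (upd q' nvars (q i < q n)) qm.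
    by rewrite /step /fetch /= f0 /= -!agq.
  rewrite /steps !iterS s1 /step /fetch /= f1.
  by rewrite /upd eqxx; case: (q i < q n).
have agU q q' v : agree q q' -> agree q (upd q' nvars v).
  by move=> agq l ln; rewrite /upd ifF ?agq // ltn_eqF.
elim: d j r1 r1' m1 => [|d IH] j r1 r1' m1 jd ag1 a1; have [ri rn] := hin _ _ _ a1.
  exists 2, r1, (upd r1' nvars (r1 i < r1 n)), m1; split=> //.
  - by rewrite (two _ _ _ ag1) ri rn ifF //; lia.
  - exact: agU.
  - by rewrite -jd addn0.
have jN : j < N by lia.
have [r2 [r2' [m2 [e ag2 q]]]] :=
  exec_body_correct wb (agU _ _ (r1 i < r1 n : nat) ag1) (hb _ _ _ jN a1).
have [k [r3 [r3' [m3 [kt s3 ag3 q3]]]]] := IH j.+1 r2 r2' m2 ltac:(lia) ag2 q.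
exists (2 + (size code + (1 + k))), r3, r3', m3; split=> //; first by lia.
rewrite !steps_add (two _ _ _ ag1) {1}ri {1}rn jN.
have defP' : P = (pre ++ [:: Op Lt nvars i n; Jumpz nvars (pc0 + size code + 3)])
    ++ code ++ (Jump pc0 :: post) by rewrite defP -!catA /=.
have := steps_straight (upd r1' nvars (r1 i < r1 n)) m1 defP' (straight_body _).
rewrite e size_cat /= addn2 => ->.
have -> : step w P 0 (State ((size pre).+2 + size code) r2' m2) = State pc0 r2' m2.
  by rewrite /step /fetch /= -addn2 f2.
by rewrite s3.
Qed.

Lemma triple_weaken (A A' B B' : assertion) cs t :
  (forall r m, A' r m -> A r m) -> (forall r m, B r m -> B' r m) ->
  triple A cs t B -> triple A' cs t B'.
Proof.
move=> hA hB h P pre post r r' m defP ag /hA a.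
have [k [r2 [r2' [m2 [kt s2 ag2 /hB b]]]]] := h P pre post r r' m defP ag a.
by exists k, r2, r2', m2.
Qed.

Lemma triple_exists (A : Type) (Pre : A -> assertion) Post cs t :
  (forall a, triple (Pre a) cs t Post) ->
  triple (fun r m => exists a, Pre a r m) cs t Post.
Proof. by move=> h P pre post r r' m defP ag [a pa]; exact: (h a P pre post r r' m defP ag pa). Qed.

End Execution.

(** * The centre of a connected triple *)

Definition lex (s1 t1 s2 t2 : nat) : bool := (s1 < s2) || (s1 == s2) && (t1 < t2).

Lemma lex_asym s1 t1 s2 t2 : lex s1 t1 s2 t2 -> ~~ lex s2 t2 s1 t1.
Proof. by rewrite /lex; lia. Qed.

Section Graph.
Variable G : sgraph.
Implicit Types (u v a b x y z : G) (A : {set G}).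

Definition nbhd v : {set G} := [set x | adj v x].
Definition deg v : nat := #|nbhd v|.
Definition trip u v x : bool := [set u; v; x] \in connected_triples G.
Definition pair_count u v : nat := #|[set x | trip u v x]|.
(* Twice the number of connected triples through [v]. *)
Definition vertex_count v : nat := \sum_x pair_count v x.

(** In a connected 3-set every vertex has a neighbour in the set, which forces two of the three
    edges. Conversely, two edges form a path through all three vertices. *)
Lemma tripE u v x : trip u v x =
  [&& u != v, v != x, u != x &
    [|| adj u v && adj v x, adj v x && adj x u | adj x u && adj u v]].
Proof.
have card3 : (#|[set u; v; x]| == 3) = [&& u != v, v != x & u != x].
  rewrite -setUA cardsU1 cards2 !inE negb_or.
  by case: (u == v); case: (v == x); case: (u == x).
rewrite /trip inE card3 -!andbA.
have [//|uv] := eqVneq u v; have [//|vx] := eqVneq v x; have [//|ux] := eqVneq u x.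
rewrite /=; set A := [set u; v; x].
have iE (y z : G) : induced_adj A y z = [&& y \in A, z \in A & adj y z] by [].
have uA : u \in A by rewrite !inE eqxx.
have vA : v \in A by rewrite !inE eqxx orbT.
have xA : x \in A by rewrite !inE eqxx !orbT.
have sI : connect_sym (induced_adj A).
  apply: sym_connect_sym => y z; rewrite !iE adj_sym.
  by case: (y \in A); case: (z \in A).
have c1 y z : y \in A -> z \in A -> adj y z -> connect (induced_adj A) y z.
  by move=> yA zA yz; apply: connect1; rewrite iE yA zA.
have esc y z : y \in A -> z \in A -> y != z -> induced_connected A ->
    exists2 t, t \in A & adj y t.
  move=> yA zA yz /forall_inP/(_ _ yA)/forall_inP/(_ _ zA)/connectP[[|t p] /=].
    by move=> _ e; rewrite e eqxx in yz.
  by rewrite iE => /andP[/and3P[_ tA yt] _] _; exists t.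
apply/idP/idP => [cA|].
  have {}esc y : y \in A -> exists2 t, t \in A & adj y t.
    move=> yA; have [z zA yz] : exists2 z, z \in A & y != z.
      by have [e|] := eqVneq y u; [exists v; rewrite // e|exists u].
    exact: esc yz cA.
  have [t1] := esc u uA; have [t2] := esc v vA; have [t3] := esc x xA.
  rewrite !inE -!orbA.
  move=> /or3P[] /eqP-> + /or3P[] /eqP-> + /or3P[] /eqP->; rewrite ?adj_irr //;
    rewrite ?[adj v u]adj_sym ?[adj x v]adj_sym ?[adj u x]adj_sym;
    by case: (adj u v); case: (adj v x); case: (adj x u).
have build p q s : p \in A -> q \in A -> s \in A -> A =i [:: p; q; s] ->
    adj p q -> adj q s -> induced_connected A.
  move=> pA qA sA AE pq qs.
  have pqs y : y \in A -> connect (induced_adj A) p y.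
    rewrite AE !inE => /or3P[] /eqP->; first exact: connect0; first exact: c1.
    by apply: connect_trans (c1 _ _ pA qA pq) (c1 _ _ qA sA qs).
  apply/forall_inP=> y yA; apply/forall_inP=> z zA.
  by apply: connect_trans (pqs _ zA); rewrite sI pqs.
case/or3P=> /andP[h1 h2].
- by apply: (build u v x) => // y; rewrite !inE -orbA.
- by apply: (build v x u) => // y; rewrite !inE; do 3! case: eqP => //=.
- by apply: (build x u v) => // y; rewrite !inE; do 3! case: eqP => //=.
Qed.

Lemma trip_swap12 u v x : trip u v x = trip v u x.
Proof. by rewrite /trip (setUC [set u]). Qed.

Lemma trip_swap23 u v x : trip u v x = trip u x v.
Proof. by rewrite /trip setUAC. Qed.

Lemma pair_countC u v : pair_count u v = pair_count v u.
Proof. by apply: eq_card => x; rewrite !inE trip_swap12. Qed.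

Lemma pair_count_refl v : pair_count v v = 0.
Proof. by apply: eq_card0 => x; rewrite !inE tripE eqxx. Qed.

Hypothesis conn : connected_graph G.
Hypothesis tfree : triangle_free G.

Lemma adj_neq u v : adj u v -> u != v.
Proof. by apply: contraTneq => ->; rewrite adj_irr. Qed.

Lemma no_triangle u v x : adj u v -> adj v x -> adj u x = false.
Proof.
move=> uv vx; apply: negbTE; have := tfree u v x.
by rewrite uv vx (adj_sym x).
Qed.

(** The third vertices are the neighbours of [u] other than [v] and those of [v] other than [u];
    without triangles these sets are disjoint. *)
Lemma pair_count_adj u v : adj u v -> pair_count u v = (deg u).-1 + (deg v).-1.
Proof.
move=> uv; have vu : adj v u by rewrite adj_sym.
rewrite /pair_count; have -> : [set x | trip u v x] =
    (nbhd u :\ v) :|: (nbhd v :\ u).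
  apply/setP=> x; rewrite !inE tripE adj_neq //= uv (adj_sym x) /= andbT.
  rewrite (eq_sym v x) (eq_sym u x).
  have [->|] := eqVneq x u; first by rewrite adj_irr !andbF.
  have [->|] := eqVneq x v; first by rewrite adj_irr !andbF.
  by move=> _ _ /=; case: (adj v x); case: (adj u x).
rewrite cardsU (_ : _ :&: _ = set0) ?cards0 ?subn0.
  by rewrite /deg (cardsD1 v (nbhd u)) (cardsD1 u (nbhd v)) !inE uv vu.
apply/setP=> x; rewrite !inE; apply/negP=> /andP[/andP[_ ux] /andP[_ vx]].
by move: (no_triangle uv vx); rewrite ux.
Qed.

Lemma pair_count_nonadj u v : u != v -> ~~ adj u v ->
  pair_count u v = #|nbhd u :&: nbhd v|.
Proof.
move=> uv nuv; apply: eq_card => x; rewrite !inE tripE uv (negbTE nuv) (adj_sym x) /= andbF orbF.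
case: (boolP (adj v x)) => [vx|]; rewrite ?andbF //=.
case: (boolP (adj u x)) => ux; rewrite ?andbF //=.
by rewrite !adj_neq.
Qed.

Lemma sum_nbhd (F : G -> nat) v :
  \sum_(x in nbhd v) F x = \sum_x adj v x * F x.
Proof.
rewrite big_mkcond; apply: eq_bigr => x _; rewrite inE.
by case: (adj v x); rewrite ?mul1n ?mul0n.
Qed.

Lemma degE v : deg v = \sum_x adj v x.
Proof.
rewrite /deg -sum1_card sum_nbhd; apply: eq_bigr => x _; exact: muln1.
Qed.

(** The triples centred at [v] give the first term; those with end [v] and centre [y] number
    [(deg y).-1]. Both kinds are counted twice. *)
Lemma vertex_countE v : vertex_count v =
  deg v * (deg v).-1 + 2 * \sum_(y in nbhd v) (deg y).-1.
Proof.
rewrite /vertex_count.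
(* One formula for all [x]: the inner sum vanishes for neighbours of [v] by triangle-freeness, and
   counts common neighbours otherwise. *)
have e x : pair_count v x = adj v x * ((deg v).-1 + (deg x).-1)
    + (x != v) * \sum_(y in nbhd v) adj y x.
  have [->|xv] := eqVneq x v.
    by rewrite pair_count_refl adj_irr !mul0n.
  rewrite mul1n; case: (boolP (adj v x)) => vx.
    rewrite pair_count_adj // big1 ?mul1n ?addn0 // => y; rewrite inE => vy.
    by rewrite adj_sym (@no_triangle x v y) // adj_sym.
  rewrite pair_count_nonadj ?mul0n ?add0n 1?eq_sym //.
  rewrite -sum1_card (eq_bigl (fun y => (y \in nbhd v) && (adj y x))).
    by rewrite big_mkcondr /=; apply: eq_bigr => y _; case: (adj y x).
  by move=> y; rewrite !inE (adj_sym x).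
rewrite (eq_bigr _ (fun x _ => e x)) big_split /=.
under eq_bigr do rewrite mulnDr.
rewrite big_split /= -big_distrl /= -degE -addnA; congr (_ + _).
rewrite -sum_nbhd mul2n -addnn; congr (_ + _).
under eq_bigr do rewrite big_distrr /=.
rewrite exchange_big /=; apply: eq_bigr => y; rewrite inE => vy.
rewrite degE (bigD1 v) //= [in RHS](bigD1 v) //= eqxx (adj_sym y) vy.
by apply: eq_bigr => x ->; rewrite mul1n.
Qed.

(** A path from a vertex of [A] to a vertex outside has a first edge that leaves [A]. *)
Lemma boundary_edge A : A != set0 -> #|A| < #|G| ->
  exists y z, [/\ y \in A, z \notin A & adj y z].
Proof.
move=> /set0Pn[y0 y0A] cA.
have [z0 z0A] : exists z, z \notin A.
  apply/existsP; rewrite -[X in is_true X]negbK negb_exists.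
  apply: contraL cA => /forallP all; rewrite -leqNgt subset_leq_card //.
  by apply/subsetP=> z _; have := all z; rewrite negbK.
have /forall_inP/(_ y0)/(_ (in_setT _))/forall_inP/(_ z0 (in_setT _)) := conn.
case/connectP=> p; elim: p y0 y0A => [|t p IH] y0 y0A /=.
  by move=> _ e; rewrite e y0A in z0A.
case/andP=> /and3P[_ _ yt] pp e.
have [tA|tA] := boolP (t \in A); first exact: IH tA pp e.
by exists y0, t.
Qed.

Hypothesis card5 : 5 <= #|G|.

(** Some edge leaves the set of [u] and [v], and its outer end completes a triple. *)
Lemma edge_in_trip u v : adj u v -> exists x, trip u v x.
Proof.
move=> uv; have [||y [z []]] := @boundary_edge [set u; v].
- by apply/set0Pn; exists u; rewrite !inE eqxx.
- by rewrite cards2 (leq_trans _ card5) // ltnS; case: (u != v).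
rewrite !inE negb_or => yuv /andP[zu zv] yz; exists z; rewrite tripE adj_neq //.
rewrite uv (adj_sym z) (eq_sym v) zv (eq_sym u) zu /= andbT.
by case/orP: yuv yz => /eqP-> ->; rewrite ?orbT.
Qed.

Lemma vertex_in_edge u : exists v, adj u v.
Proof.
have [||y [z []]] := @boundary_edge [set u].
- by apply/set0Pn; exists u; rewrite !inE eqxx.
- by rewrite cards1 (leq_trans _ card5).
by rewrite !inE => /eqP-> _; exists z.
Qed.

(** Triples have 3 vertices and together cover at least 5. The bound makes the logarithm in the
    running time positive. *)
Lemma card_connected_triples_gt1 : 1 < #|connected_triples G|.
Proof.
have cov : cover (connected_triples G) = [set: G].
  apply/setP=> u; rewrite in_setT; have [v uv] := vertex_in_edge u.
  have [x t] := edge_in_trip uv; apply/bigcupP.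
  by exists [set u; v; x] => //; rewrite !inE eqxx.
have : #|cover (connected_triples G)| <= \sum_(A in connected_triples G) 3.
  apply: leq_trans (leq_card_cover _) _.
  by rewrite leq_eqVlt (eq_bigr (fun=> 3)) ?eqxx // => A; rewrite inE => /andP[/eqP].
rewrite cov cardsT sum_nat_const => h.
by have := leq_trans card5 h; lia.
Qed.

Lemma lex_center u b a : adj u b -> adj b a -> u != a ->
  lex (pair_count u a) (vertex_count b) (pair_count u b) (vertex_count a).
Proof.
move=> ub ba ua; have nua := no_triangle ub ba.
have bu : adj b u by rewrite adj_sym.
have ab : adj a b by rewrite adj_sym.
rewrite /lex (pair_count_adj ub) pair_count_nonadj ?nua //.
have du : 0 < deg u by apply/card_gt0P; exists b; rewrite inE.
have sub2 : [set u; a] \subset nbhd b.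
  by apply/subsetP=> x; rewrite !inE => /orP[] /eqP->.
have db : 1 < deg b.
  by rewrite /deg; have := subset_leq_card sub2; rewrite cards2 ua.
have capu : #|nbhd u :&: nbhd a| <= deg u by rewrite subset_leq_card ?subsetIl.
(* What remains is equality of the first components, which forces [deg b = 2] and puts [N(u)] inside
   [N(a)]. *)
have [//|geq /=] := ltnP #|nbhd u :&: nbhd a| ((deg u).-1 + (deg b).-1).
have db2 : deg b = 2 by lia.
have capE : #|nbhd u :&: nbhd a| = deg u by lia.
rewrite capE db2 /= addn1 prednK // eqxx /=.
have sua : nbhd u \subset nbhd a.
  have /eqP <- : nbhd u :&: nbhd a == nbhd u.
    by rewrite eqEcard subsetIl capE leqnn.
  exact: subsetIr.
have nb : nbhd b = [set u; a].
  by apply/esym/eqP; rewrite eqEcard sub2 cards2 ua -/(deg b) db2.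
have da : deg u <= deg a by apply: subset_leq_card.
rewrite !vertex_countE db2 nb (big_setU1 _ _) ?inE //= big_set1.
have mem2 x : x \in nbhd u -> 1 < deg x.
  move=> xu; have xa := subsetP sua x xu; rewrite !inE in xu xa.
  have : [set u; a] \subset nbhd x.
    by apply/subsetP=> y; rewrite !inE => /orP[] /eqP->; rewrite adj_sym.
  by move/subset_leq_card; rewrite cards2 ua.
(* A neighbour of [u] is adjacent to [u] and [a], so it contributes at least 1 to the sum over
   [N(a)]. *)
have low x : adj u x <= adj a x * (deg x).-1.
  case: (boolP (adj u x)) => // ux.
  have := subsetP sua x; rewrite !inE => /(_ ux) ->.
  by have := mem2 x; rewrite inE mul1n => /(_ ux); case: (deg x) => [|[|]].
have lower : deg u <= \sum_(y in nbhd a) (deg y).-1.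
  by rewrite [deg u]degE [X in _ <= X]sum_nbhd; apply: leq_sum.
(* The count of [b] is [2 * deg u + 2 * (deg a).-1], and by [lower] that of [a] is at least
   [2 * deg u + deg a * (deg a).-1]. This settles [deg a >= 3]; otherwise a strict form of [lower]
   suffices. *)
have [m3|m2] := leqP 3 (deg a).
  have : 3 * (deg a).-1 <= deg a * (deg a).-1 by rewrite leq_mul2r m3 orbT.
  by move: lower du; clear -m3; lia.
(* At most 4 vertices, as [deg a <= 2]. Since [N(u)] lies in [N(a)], the inner end [y] of the
   leaving edge must be a neighbour of [a]. *)
have [||y [z [yA zA yz]]] := @boundary_edge (u |: (a |: nbhd a)).
- by apply/set0Pn; exists u; rewrite !inE eqxx.
- rewrite !cardsU1 -/(deg a) (leq_trans _ card5) //.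
  by clear -m2; case: (_ \notin _); case: (_ \notin _) => /=; lia.
have bz : b != z by apply: contraNneq zA => <-; rewrite !inE ab !orbT.
have [zu za nza] : [/\ z != u, z != a & ~~ adj a z].
  by move: zA; rewrite !inE !negb_or => /and3P[].
have ya : adj a y.
  move: yA; rewrite !inE => /or3P[/eqP ey|/eqP ey|//]; rewrite ey in yz.
    have := subsetP sua z; rewrite !inE => /(_ yz) az.
    by rewrite az in nza.
  by rewrite yz in nza.
have lower1 : deg u < \sum_(x in nbhd a) (deg x).-1.
  rewrite [deg u]degE [X in _ < X]sum_nbhd (bigD1 y) //= [X in _ < X](bigD1 y) //=.
  rewrite -addSn; apply: leq_add; last exact: leq_sum.
  rewrite ya mul1n.
  (* The extra neighbour [z] makes the term of [y] exceed its share [adj u y] of [deg u]. *)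
  have : a |: (z |: (if adj u y then [set u] else set0)) \subset nbhd y.
    apply/subsetP=> x; rewrite !inE => /or3P[/eqP->|/eqP->|]; rewrite ?(adj_sym y a) //.
    by case: ifP => [uy|_]; rewrite !inE // => /eqP->; rewrite adj_sym.
  move/subset_leq_card; rewrite -/(deg y) !cardsU1 !inE (eq_sym a z) negb_or za.
  case: ifP => _; rewrite ?inE ?cards1 ?cards0 ?(eq_sym a u) ?ua ?zu /=;
    by case: (deg y) => [|[|[|]]].
move: m2 lower1 da du; case: (deg a) => [|[|[|]]] //= _; clear; lia.
Qed.

(** By [lex_center] the centre strictly beats the two ends, so by asymmetry [b] beats both [u] and
    [a] exactly when it is the centre, that is, when [u] and [a] are not adjacent. *)
Lemma adj_lex u a b : trip u a b ->
  adj u a = ~~ (lex (pair_count u a) (vertex_count b) (pair_count u b) (vertex_count a)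
    && lex (pair_count u a) (vertex_count b) (pair_count a b) (vertex_count u)).
Proof.
rewrite tripE => /and4P[ua ab ub /or3P[] /andP[h1 h2]].
- have := lex_center h1 h2 ub; rewrite h1 => /lex_asym/negbTE ->.
  by [].
- have ub' : adj u b by rewrite adj_sym.
  have ba' : adj b a by rewrite adj_sym.
  rewrite (no_triangle ub' ba') lex_center // (pair_countC u a).
  by rewrite lex_center // eq_sym.
- have ba : b != a by rewrite eq_sym.
  have au : adj a u by rewrite adj_sym.
  have ub' : adj u b by rewrite adj_sym.
  have := lex_center au ub' ab; rewrite h2 (pair_countC a u) => /lex_asym/negbTE ->.
  by rewrite andbF.
Qed.

End Graph.

(** * The reconstruction program *)

Declare Scope expr_scope.
Delimit Scope expr_scope with E.
Bind Scope expr_scope with expr.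
Notation "a + b" := (Bin Add a b) : expr_scope.
Notation "a - b" := (Bin Sub a b) : expr_scope.
Notation "a * b" := (Bin Mul a b) : expr_scope.
Notation "a / b" := (Bin Div a b) (at level 40, left associativity) : expr_scope.
Notation "a %% b" := (Bin Mod a b) : expr_scope.
Notation "a < b" := (Bin Lt a b) : expr_scope.
Notation "a == b" := (Bin Eq a b) : expr_scope.
Notation "# n" := (Num n) (at level 0, n at level 0, format "# n") : expr_scope.
Notation "$ v" := (Var v) (at level 0, v at level 0, format "$ v") : expr_scope.
Notation "v ::= e" := (Assign v e%E) (at level 90).
Notation "a <~ e" := (Store a%E e%E) (at level 90).

(* With [T] triples, register 0 holds [N = 3 * T], register 1 holds
   [S = 5 * N] and register 2 holds [2 * N].  The memory below [8 * S] is
   divided into arrays of length [S], array [k] starting at [k * S]: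
   0 input and output, 1 labels, 2 names of the vertices (the first position
   of the vertex in the input), 3 successors in the list of ordered pairs,
   4 last representative seen for each second vertex, 5 representatives of
   pairs, 6 pair counts, 7 vertex counts.  The label table starts at [8 * S]
   and has [2 ^ (w - 1)] entries. *)
Definition addr (k : nat) (e : expr) : expr := (#k * $1 + e)%E.
Definition cell (k : nat) (e : expr) : expr := Deref (addr k e).
(** A conditional without jumps, for [c] equal to 0 or 1; it keeps loop bodies straight-line. *)
Definition select (c a b : expr) : expr := (c * a + (#1 - c) * b)%E.

Definition setup : seq stmt :=
  [:: 0 ::= #3 * Deref #0; 1 ::= #5 * $0; 2 ::= #2 * $0; 3 ::= #0; 4 ::= #0].

(* Only labels of parity [r_4] are treated, so that no two labels compete for
   the same table entry during one traversal of the input. *)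
Definition name_body : seq stmt :=
  [:: 5 ::= $3 + #1;
      6 ::= Deref $5;
      7 ::= cell 8 ($6 / #2);
      8 ::= (Deref $7 == $6) * $7;
      9 ::= $8 + ($8 == #0) * $5;
      10 ::= $6 %% #2 == $4;
      addr 8 ($6 / #2) <~ select $10 $9 $7;
      addr 1 $5 <~ $6;
      addr 2 $5 <~ select $10 $9 (cell 2 $5);
      3 ::= $3 + #1].

Ltac no_overflow :=
  repeat match goal with |- _ /\ _ => split; [solve [done | lia | nia] |] end.

(* The ordered pairs are numbered from 2: the pair [o] consists of the vertex
   at position [o %/ 2] of the input and of the vertex [1 + o %% 2] places
   further, cyclically, in the same triple.  A pair is inserted in the list
   right after the first pair that has the same first vertex, hence the list
   is grouped by first vertex; 0 is both its head and its end marker. *)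
Definition link_body : seq stmt :=
  [:: 5 ::= $3 + #2;
      6 ::= #2 * cell 2 ($5 / #2);
      7 ::= (#1 - ($6 == $5)) * $6;
      addr 3 $5 <~ cell 3 $7;
      addr 3 $7 <~ $5;
      3 ::= $3 + #1].

(** Equal entries are contiguous. The default [x] of [head] makes the test trivial at the last
    entry. *)
Fixpoint grouped (s : seq nat) : bool :=
  if s is x :: s' then ((x == head x s') || (x \notin s')) && grouped s' else true.

Lemma grouped_split s1 y s2 : grouped (s1 ++ y :: s2) -> (last y s1 == y) || (y \notin s1).
Proof.
elim: s1 => [|x s1 IH] /=; first by rewrite eqxx.
case/andP=> hx /IH; case: s1 hx {IH} => [|z s1] /=.
  by rewrite !inE eq_sym orbN.
move=> hx /orP[->//|yn]; rewrite [y \in _ :: _]inE negb_or yn andbT.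
apply/orP; right; apply: contraTneq hx => xy; rewrite -xy in yn *.
rewrite negb_or negbK in_cons mem_cat mem_head !orbT andbT.
by apply: contraNneq yn => ->; rewrite mem_head.
Qed.

Lemma grouped_insert s1 x s2 : grouped (s1 ++ x :: s2) -> grouped (s1 ++ x :: x :: s2).
Proof.
elim: s1 => [|y s1 IH] /=; first by rewrite eqxx.
case/andP=> hy /IH ->; rewrite andbT.
have -> : (y \in s1 ++ [:: x, x & s2]) = (y \in s1 ++ x :: s2).
  by rewrite !mem_cat !inE; case: (y == x).
by case: s1 hy {IH}.
Qed.

Lemma fpath_eq_in (f g : nat -> nat) x p : {in belast x p, f =1 g} ->
  fpath f x p -> fpath g x p.
Proof.
elim: p x => //= y p IH x fg /andP[fx py]; rewrite -fg ?mem_head // fx.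
by apply: IH py => a ap; rewrite fg // in_cons ap orbT.
Qed.

(** Insertion into a linked list: [f] and [g] are the successor maps before and after [o] is placed
    behind [z]. *)
Lemma fpath_splice (f g : nat -> nat) z o s : g z = o -> g o = f z ->
  {in s, f =1 g} -> fpath f z (rcons s 0) -> fpath g z (rcons (o :: s) 0).
Proof.
move=> gz go fg; rewrite /= gz eqxx /=.
case: s fg => [|y s] fg /=; rewrite go; first by [].
case/andP=> -> /=; apply: fpath_eq_in => a; rewrite belast_rcons; exact: fg.
Qed.

Definition other_expr (p s : expr) : expr :=
  (#3 * ((p - #1) / #3) + #1 + ((p - #1) %% #3 + #1 + s) %% #3)%E.

(* The last representative seen with second vertex [r_8] is reused when it
   has first vertex [r_7]; since pairs are grouped by first vertex, all pairs
   with the same vertices in the same order get the same representative. *)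
Definition pair_body : seq stmt :=
  [:: 6 ::= $5 / #2;
      7 ::= cell 2 $6;
      8 ::= cell 2 (other_expr $6 ($5 %% #2));
      9 ::= cell 4 $8;
      10 ::= cell 2 ($9 / #2) == $7;
      11 ::= select $10 $9 $5;
      addr 4 $8 <~ $11;
      addr 5 $5 <~ $11;
      addr 6 $11 <~ cell 6 $11 + #1;
      addr 7 $7 <~ cell 7 $7 + #1;
      5 ::= cell 3 $5;
      3 ::= $3 + #1].

Definition other (p s : nat) : nat :=
  3 * ((p - 1) %/ 3) + 1 + ((p - 1) %% 3 + 1 + s) %% 3.

(** The two alternatives exclude each other, so their sum is a disjunction. *)
Definition lex_expr (s1 t1 s2 t2 : expr) : expr :=
  ((s1 < s2) + (s1 == s2) * (t1 < t2))%E.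

(* Each iteration writes a candidate edge at the end of the output, but the
   number of edges [r_4] is only incremented if the candidate is accepted. *)
Definition emit_body : seq stmt :=
  [:: 5 ::= $3 + #2;
      6 ::= $5 / #2;
      7 ::= $5 %% #2;
      8 ::= other_expr $6 $7;
      9 ::= other_expr $6 (#1 - $7);
      10 ::= cell 6 (cell 5 $5);
      11 ::= cell 6 (cell 5 (#2 * $6 + (#1 - $7)));
      12 ::= cell 6 (cell 5 (#2 * $8 + $7));
      13 ::= cell 7 (cell 2 $6);
      14 ::= cell 7 (cell 2 $8);
      15 ::= cell 7 (cell 2 $9);
      16 ::= lex_expr $10 $15 $11 $14;
      17 ::= lex_expr $10 $15 $12 $13;
      18 ::= cell 5 $5 == $5;
      19 ::= cell 1 $6 < cell 1 $8;
      20 ::= (#1 - $16 * $17) * ($18 * $19);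
      #2 * $4 + #1 <~ cell 1 $6;
      #2 * $4 + #2 <~ cell 1 $8;
      4 ::= $4 + $20;
      3 ::= $3 + #1].

(** * Naming the vertices *)

Section Machine.
Variables (w T : nat) (xs : seq nat).
Let N := 3 * T.
Let S := 5 * N.
Hypothesis T2 : 1 < T.
(* The arrays fill [8 * S = 120 * T] cells; the label table needs half of the
   memory. *)
Hypothesis wT : 240 * T <= 2 ^ w.
Hypothesis xsN : size xs = N.
Hypothesis xsw : forall x, x \in xs -> x < 2 ^ w.

(** Positions start at 1 because cell 0 of the input holds the number of triples; a table entry 0
    thus means that no position is recorded. *)
Definition lab (p : nat) := nth 0 xs p.-1.
Definition first_pos (x : nat) := (index x xs).+1.
Definition name (p : nat) := first_pos (lab p).

(** The second branch describes stale entries that the even traversal leaves behind for the odd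
    one. *)
Definition label_table (par i b : nat) :=
  if 2 * b + par \in take i xs then first_pos (2 * b + par)
  else if (par == 1) && (2 * b \in xs) then first_pos (2 * b) else 0.

Definition named (par i p : nat) : bool :=
  (lab p %% 2 < par) || (lab p %% 2 == par) && (p <= i).

Definition name_inv (par i : nat) : assertion := fun r m =>
  [/\ r 0 = N, r 1 = S, r 2 = 2 * N, r 3 = i & r 4 = par] /\
  [/\ forall p, 0 < p <= N -> m p = lab p,
      forall p, 0 < p <= i -> m (1 * S + p) = lab p,
      forall p, p < S ->
        m (2 * S + p) = if (0 < p <= N) && named par i p then name p else 0,
      forall a, 3 * S <= a < 8 * S -> m a = 0 &
      forall b, 2 * b < 2 ^ w -> m (8 * S + b) = label_table par i b].

Lemma lab_in p : 0 < p <= N -> lab p \in xs.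
Proof. by move=> pN; apply: mem_nth; rewrite xsN; lia. Qed.

Lemma first_pos_le x : x \in xs -> 0 < first_pos x <= N.
Proof. by rewrite -xsN -index_mem. Qed.

Lemma lab_first_pos x : x \in xs -> lab (first_pos x) = x.
Proof. exact: nth_index. Qed.

Lemma label_table_le par i b : label_table par i b <= N.
Proof.
rewrite /label_table; case: ifP => [/mem_take/first_pos_le/andP[]//|_].
by case: ifP => [/andP[_ /first_pos_le/andP[]]|].
Qed.

Lemma name_body_correct par i r m : par < 2 -> i < N ->
  name_inv par i r m -> wp w name_body (name_inv par i.+1) r m.
Proof.
move=> par2 iN [[r0 r1 r2 r3 r4] [inp labs ids zero tab]].
rewrite /= /upd /= r1 r3 r4.
split; first by lia. split; first by lia.
move=> p pE.
have pN : 0 < p <= N by lia.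
rewrite inp //; move=> x xE.
have xin : x \in xs by rewrite xE lab_in.
have xw := xsw xin.
do 5! (split; first by lia); move=> q qE.
have {qE} : q = label_table par i (x %/ 2) by rewrite qE tab //; lia.
set b := x %/ 2 => qE.
have qN : q <= N by rewrite qE label_table_le.
have pe : p.-1 = i by lia.
have xi : x \in take i.+1 xs.
  by rewrite (take_nth 0) ?xsN // mem_rcons xE /lab pe mem_head.
have takeS y : y \in take i.+1 xs = (y == x) || (y \in take i xs).
  by rewrite (take_nth 0) ?xsN // mem_rcons xE /lab pe in_cons.
split=> //; split; first by case: eqP => _ /=; lia.
move=> v vE; split; first by lia.
split=> //; split; first by case: eqP => _ /=; lia.
have vN : v <= N by move: vE; case: eqP => _ -> /=; lia.
split; first by case: eqP => _ /=; lia.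
move=> f fE.
have fN : f <= N by move: fE; case: eqP => [v0|_] -> /=; lia.
split; first by lia.
do 2! split=> //; move=> c cE.
have c1 : c <= 1 by rewrite cE; case: eqP.
(* An entry is trusted only if the input at that position is [x]. If [x] is new, the entry is 0 or a
   stale one for an even label while [x] is odd; it is rejected and the current position becomes the
   name. *)
have fpos : x %% 2 = par -> f = first_pos x.
  move=> xpar; have x2 : 2 * b + par = x by rewrite /b; lia.
  have [xold|xnew] := boolP (x \in take i xs).
    have qx : q = first_pos x by rewrite qE /label_table x2 xold.
    have xx := mem_take xold; have := first_pos_le xx.
    rewrite fE vE qx inp ?first_pos_le // lab_first_pos // eqxx mul1n.
    by rewrite /first_pos /= mul0n addn0.
  have v0 : v = 0.
    rewrite vE qE /label_table x2 (negbTE xnew); case: ifP => [/andP[/eqP p1 h]|_]; last by lia.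
    rewrite inp ?first_pos_le // lab_first_pos //; case: eqP => // e.
    by lia.
  rewrite fE v0 eqxx mul1n add0n /first_pos.
  have := xi; rewrite in_take; last by [].
  move=> ix; have : ~~ (index x xs < i) by rewrite -in_take.
  by lia.
have selE y z : c * y + (1 - c) * z = if x %% 2 == par then y else z.
  by rewrite cE; case: eqP => _ /=; lia.
no_overflow; rewrite selE.
move=> m1 m1E; no_overflow.
move=> m2 m2E.
have m2p : m2 (2 * S + p) = if named par i p then name p else 0.
  rewrite m2E ifF; last by lia.
  rewrite m1E ifF; last by lia.
  by rewrite ids ?pN //; lia.
have nameN : name p <= N.
  by have /andP[] := first_pos_le (lab_in pN).
have idN : m2 (2 * S + p) <= N by rewrite m2p; case: ifP.
no_overflow; rewrite selE.
move=> m3 m3E; no_overflow.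
move=> i' i'E; split; first by split=> //=; lia.
have m3o a : a != 8 * S + b -> a != 1 * S + p -> a != 2 * S + p -> m3 a = m a.
  by move=> h1 h2 h3; rewrite m3E m2E m1E !ifF //; apply: negbTE.
split.
- by move=> p' p'N; rewrite m3o ?inp //; lia.
- move=> p' p'i; have [->|pp] := eqVneq p' p.
    by rewrite m3E m2E ifF ?eqxx //; lia.
  by rewrite m3o ?labs //; lia.
- move=> p' p'S; have [->|pp] := eqVneq p' p.
    rewrite m3E eqxx m2p pN /= /named -xE.
    have [xpar|xpar] := boolP (x %% 2 == par).
      by rewrite (fpos (eqP xpar)) (_ : p <= i.+1) ?orbT ?xE //; lia.
    by rewrite orbF.
  rewrite m3o ?ids //; try lia.
  case: (boolP (0 < p' <= N)) => //= p'N; rewrite /named.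
  by have -> : (p' <= i.+1) = (p' <= i) by lia.
- by move=> a aS; rewrite m3o ?zero //; lia.
move=> b' b'w; have [eb|bb] := eqVneq b' b.
  rewrite eb m3E ifF; last by lia.
  rewrite m2E ifF; last by lia.
  rewrite m1E eqxx.
  rewrite /label_table takeS; have [xpar|xpar] := boolP (x %% 2 == par).
    have -> : 2 * b + par = x by rewrite /b; move/eqP: xpar; lia.
    by rewrite eqxx (fpos (eqP xpar)).
  have -> : (2 * b + par == x) = false by rewrite /b; lia.
  by rewrite qE.
rewrite m3o ?tab //; try lia.
rewrite /label_table takeS (_ : 2 * b' + par == x = false) //.
by rewrite /b in bb; lia.
Qed.

Definition sized (r : nat -> nat) := [/\ r 0 = N, r 1 = S & r 2 = 2 * N].

Definition named_mem (m : nat -> nat) :=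
  (forall p, 0 < p <= N -> m (1 * S + p) = lab p) /\
  (forall p, p < S -> m (2 * S + p) = if 0 < p <= N then name p else 0).

Definition name_cmds : seq cmd :=
  map Do setup ++ [:: Loop 3 0 name_body] ++
  map Do [:: 3 ::= #0; 4 ::= #1] ++ [:: Loop 3 0 name_body].

Definition name_time : nat :=
  size (compile_body setup) + (N * (size (compile_body name_body) + 3) + 2 +
  (size (compile_body [:: 3 ::= #0; 4 ::= #1]) +
   (N * (size (compile_body name_body) + 3) + 2))).

Lemma name_correct :
  triple w (fun r m => m =1 nth 0 (T :: xs)) name_cmds name_time
    (fun r m => [/\ sized r, named_mem m & forall a, 3 * S <= a < 8 * S -> m a = 0]).
Proof.
have par_loop par : par < 2 -> triple w (name_inv par 0) [:: Loop 3 0 name_body]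
    (N * (size (compile_body name_body) + 3) + 2) (name_inv par N).
  move=> par2; apply: triple_loop => //; first by move=> j r m [[]].
  by move=> j r m jN; apply: name_body_correct.
apply: triple_cat; first apply: (triple_do (B := name_inv 0 0)) => //.
  move=> r m m0; rewrite /= /upd /= !m0 /=; no_overflow.
  move=> y0 ->; no_overflow => y1 ->; no_overflow => y2 ->; no_overflow => y3 ->.
  no_overflow => y4 ->; split=> //; rewrite -/N -/S.
  have m0' a : N < a -> m a = 0 by case: a => // a aN; rewrite m0 /= nth_default ?xsN.
  split.
  - by move=> [|p] // _; rewrite m0.
  - by lia.
  - move=> p pS; rewrite m0'; last by lia.
    by rewrite /named; case: ifP => //; lia.
  - by move=> a aS; rewrite m0' //; lia.
  - by move=> b _; rewrite m0' /label_table ?take0 //; lia.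
apply: triple_cat; first exact: par_loop.
apply: triple_cat; last first.
  apply: triple_weaken (par_loop 1 _) => // r m.
    by move=> h; exact: h.
  case=> [[r0 r1 r2 _ _] [_ labs ids zero _]]; split=> //; split=> // p pS.
  rewrite ids //; case: (boolP (0 < p <= N)) => //= pN.
  by rewrite /named; case: ifP => //; lia.
(* The end of the even traversal is a valid start of the odd one: even labels are named, and the
   full even table is the stale part of the odd table. *)
apply: triple_do => // r m [[r0 r1 r2 r3 r4] [inp labs ids zero tab]].
rewrite /= /upd /=; no_overflow => i ->; no_overflow => par ->.
split=> //; split=> //; first by lia.
- move=> p pS; rewrite ids //; case: (boolP (0 < p <= N)) => //= pN.
  rewrite /named; congr (if _ then _ else _).
  by case/andP: pN => p0 pN; rewrite pN; lia.
- move=> b bw; rewrite tab // /label_table take0 take_oversize ?xsN //=.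
  by rewrite addn0; case: ifP.
Qed.

(** * The list of ordered pairs, grouped by first vertex *)

Definition pair_fst (o : nat) := name (o %/ 2).

(** A first occurrence comes no later than [p]; hence the pair behind which a new pair is inserted
    is already listed. *)
Lemma name_bounds p : 0 < p <= N -> 0 < name p <= p.
Proof.
move=> pN; rewrite /name /first_pos /=.
have := mem_nth 0 (_ : p.-1 < size xs) => /(_ ltac:(lia)); rewrite -/(lab p) => lin.
have : lab p \in take p xs.
  have {2}-> : p = p.-1.+1 by lia.
  by rewrite (take_nth 0) ?mem_rcons ?mem_head //; lia.
by rewrite in_take.
Qed.

Lemma name_idem p : 0 < p <= N -> name (name p) = name p.
Proof.
move=> pN; rewrite /name /lab /= nth_index //.
by apply: mem_nth; rewrite xsN; lia.
Qed.

Definition linked (m : nat -> nat) (l : seq nat) :=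
  fpath (fun a => m (3 * S + a)) 0 (rcons l 0).

Definition link_inv (i : nat) : assertion := fun r m =>
  [/\ sized r, r 3 = i, named_mem m, forall a, 4 * S <= a < 8 * S -> m a = 0 &
    exists l, [/\ uniq l, l =i iota 2 i, linked m l & grouped (map pair_fst l)]].

Lemma link_body_correct i r m : i < 2 * N ->
  link_inv i r m -> wp w link_body (link_inv i.+1) r m.
Proof.
move=> iN [[r0 r1 r2] r3 [labs ids] zero [l [ul li lk gl]]].
rewrite /= /upd /= r1 r3; no_overflow => o oE.
have oN : 0 < o %/ 2 <= N by lia.
have := name_bounds oN; set n := name (o %/ 2) => nb.
rewrite ids ?oN -/n; last by lia.
no_overflow => q qE; no_overflow => z zE.
have zo : z < o by move: zE; case: eqP => /= h ->; lia.
no_overflow => m1 m1E; no_overflow => m2 m2E; no_overflow => i' i'E.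
have m2o a : a != 3 * S + o -> a != 3 * S + z -> m2 a = m a.
  by move=> h1 h2; rewrite m2E m1E !ifF //; apply: negbTE.
have nz : m2 (3 * S + z) = o by rewrite m2E eqxx.
have no : m2 (3 * S + o) = m (3 * S + z).
  by rewrite m2E ifF; [rewrite m1E eqxx | lia].
have lo a : a \in l -> 1 < a < o by rewrite li mem_iota; lia.
have eql s : {subset s <= l} -> z \notin s ->
    {in s, (fun a => m (3 * S + a)) =1 (fun a => m2 (3 * S + a))}.
  move=> sl zs a /[dup] aS /sl /lo ao.
  by rewrite m2o //; [lia | apply: contraNneq zs => /addnI <-].
have oi a : (a \in iota 2 i.+1) = (a == o) || (a \in iota 2 i).
  by rewrite !mem_iota; lia.
split=> //; first by rewrite /= i'E addn1.
- by split=> p pp; rewrite m2o ?labs ?ids //; lia.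
- by move=> a aS; rewrite m2o ?zero //; lia.
have ol : o \notin l by apply/negP => /lo; lia.
(* If [z] is 0, then [o] is the first pair with its first vertex: it goes to the head, and no listed
   pair shares its group. *)
have [z0|z0] := eqVneq z 0.
  exists (o :: l); split.
  - by rewrite /= ol.
  - by move=> a; rewrite oi inE li.
  - have lkz : fpath (fun a => m (3 * S + a)) z (rcons l 0) by rewrite z0.
    rewrite /linked -[X in path _ X _]z0; apply: fpath_splice lkz => //.
    by apply: eql => //; apply/negP => /lo; lia.
  - rewrite /= gl andbT; apply/orP; right; apply/mapP=> -[a al].
    rewrite -/(pair_fst o) => na.
    have qo : q = o by move: zE qE; case: eqP => //= _; lia.
    have := lo a al => ao; have aN : 0 < a %/ 2 <= N by lia.
    have := name_bounds aN; rewrite -/(pair_fst a) -na /pair_fst -/n; lia.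
(* Otherwise [o] is inserted behind [z], which has the same first vertex because [name] is
   idempotent. *)
have zq : z = q by move: zE; case: eqP => /= _ h; lia.
have zl : z \in l by rewrite li mem_iota; lia.
case/splitPr: zl ul li lk gl lo eql ol => l1 l2 ul li lk gl lo eql ol.
exists (l1 ++ z :: o :: l2).
have pm : perm_eq (l1 ++ z :: o :: l2) (o :: l1 ++ z :: l2).
  by rewrite -cat_rcons perm_catC /= perm_cons perm_catC cat_rcons.
move: (ul); rewrite cat_uniq /= => /and3P[_ /norP[zl1 _] /andP[zl2 _]].
split.
- by rewrite (perm_uniq pm) /= ol.
- by move=> a; rewrite (perm_mem pm) oi inE li.
- move: lk; rewrite /linked !rcons_cat !rcons_cons.
  rewrite -(cat_rcons _ _ (rcons l2 0)) -(cat_rcons _ _ (o :: _)) !cat_path !last_rcons.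
  case/andP=> h1 h2; apply/andP; split.
    apply: (@fpath_eq_in (fun a => m (3 * S + a)) (fun a => m2 (3 * S + a))) h1 => a.
    rewrite belast_rcons inE => /orP[/eqP->|al].
      by rewrite m2o //; lia.
    by apply: eql (al) => // b bl; rewrite mem_cat bl.
  apply: (@fpath_splice (fun a => m (3 * S + a)) (fun a => m2 (3 * S + a))) h2 => //.
  by apply: eql => // a al; rewrite mem_cat inE al !orbT.
- have zN : 0 < z %/ 2 <= N by lia.
  have zo' : pair_fst z = pair_fst o.
    by rewrite /pair_fst -(name_idem oN) -/n; congr name; lia.
  move: gl; rewrite !map_cat /= -zo'; exact: grouped_insert.
Qed.

Definition link_cmds : seq cmd := map Do [:: 3 ::= #0] ++ [:: Loop 3 2 link_body].

Definition link_time : nat := size (compile_body [:: 3 ::= #0]) +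
  (2 * N * (size (compile_body link_body) + 3) + 2).

Lemma link_correct :
  triple w
    (fun r m => [/\ sized r, named_mem m & forall a, 3 * S <= a < 8 * S -> m a = 0])
    link_cmds link_time
    (link_inv (2 * N)).
Proof.
apply: (triple_cat (B := link_inv 0)).
  apply: triple_do => // r m [[r0 r1 r2] nm zero].
  rewrite /= /upd /=; no_overflow => i ->; split=> //.
    by move=> a aS; rewrite zero //; lia.
  exists [::]; split=> //; rewrite /linked /= zero //; rewrite /S /N in zero *; lia.
apply: triple_loop => //; first by move=> j r m [[]].
by move=> j r m jN; apply: link_body_correct.
Qed.

(** * Representatives and counts *)

Definition pair_snd (o : nat) := name (other (o %/ 2) (o %% 2)).
Definition key (o : nat) := (pair_fst o, pair_snd o).
Definition rep (l : seq nat) (o : nat) := nth 0 l (index (key o) (map key l)).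

Lemma key_rep l o : o \in l -> key (rep l o) = key o.
Proof.
move=> ol; have kl : key o \in map key l by apply: map_f.
by rewrite /rep -(nth_map _ (key 0)) ?nth_index // -(size_map key) index_mem.
Qed.

Lemma rep_in l o : o \in l -> rep l o \in l.
Proof. by move=> ol; rewrite mem_nth // -(size_map key) index_mem map_f. Qed.

Lemma rep_eq l o o' : o \in l -> o' \in l -> (rep l o == rep l o') = (key o == key o').
Proof.
move=> ol ol'; apply/eqP/eqP => [e|e]; last by rewrite /rep e.
by rewrite -(key_rep ol) e key_rep.
Qed.

Lemma other_bounds p s : 0 < p <= N -> 0 < other p s <= N.
Proof. by rewrite /other /N; lia. Qed.

Definition pair_list (l : seq nat) (m : nat -> nat) :=
  [/\ uniq l, l =i iota 2 (2 * N), linked m l & grouped (map pair_fst l)].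

(** The last two clauses concern array 4. Its entries may stem from earlier groups, but they have
    the right second vertex, and within the current group they are the representatives. *)
Definition pair_inv (l : seq nat) (i : nat) : assertion := fun r m =>
  [/\ sized r, r 3 = i, r 5 = nth 0 l i, named_mem m & pair_list l m] /\
  [/\ forall o, o \in take i l -> m (5 * S + o) = rep l o,
      forall c, c < S -> m (6 * S + c) = count (fun o => rep l o == c) (take i l),
      forall u, u < S -> m (7 * S + u) = count (fun o => pair_fst o == u) (take i l),
      forall a, a < S -> m (4 * S + a) = 0 \/
        (m (4 * S + a) \in take i l /\ pair_snd (m (4 * S + a)) = a) &
      forall o, o \in take i l -> pair_fst o = pair_fst (last 0 (take i l)) ->
        m (4 * S + pair_snd o) = rep l o].

Lemma pair_list_size l m : pair_list l m -> size l = 2 * N.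
Proof.
case=> ul li _ _; rewrite -(size_iota 2 (2 * N)); apply: perm_size.
by apply: uniq_perm; rewrite ?iota_uniq.
Qed.

Lemma linked_nth m l i : linked m l -> i < size l ->
  m (3 * S + nth 0 l i) = nth 0 l i.+1.
Proof.
move=> /pathP-/(_ 0 i.+1); rewrite size_rcons => + il => /(_ il) /eqP /=.
rewrite !nth_rcons il /= => ->; case: ltnP => // h.
by rewrite nth_default // if_same.
Qed.

Lemma pair_body_correct l i r m : i < 2 * N ->
  pair_inv l i r m -> wp w pair_body (pair_inv l i.+1) r m.
Proof.
move=> iN [[[r0 r1 r2] r3 r5 [labs ids] pl] [refs cnts tcs cel celg]].
have szl := pair_list_size pl; have [ul li lk gl] := pl.
have il : i < size l by rewrite szl.
set o := nth 0 l i in r5.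
have ol : o \in l by rewrite mem_nth.
have lo a : a \in l -> 1 < a < 2 * N + 2 by rewrite li mem_iota; lia.
have oN := lo o ol.
have ptN a : a \in l -> 0 < a %/ 2 <= N by move/lo; lia.
have pN := ptN o ol.
have tl a : a \in take i l -> a \in l by apply: mem_take.
have qN := other_bounds (o %% 2) pN.
rewrite /= /upd /= r1 r5 r3; no_overflow => p pE; rewrite -pE in pN qN *.
rewrite ids ?pN; last by lia.
no_overflow => u uE.
have uN : 0 < u <= N by have := name_bounds pN; rewrite -uE; lia.
no_overflow.
rewrite ids -/(other p (o %% 2)); last by lia.
rewrite qN => a aE.
have aN : 0 < a <= N by have := name_bounds qN; rewrite -aE; lia.
have uo : pair_fst o = u by rewrite uE pE.
have ao : pair_snd o = a by rewrite aE pE.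
no_overflow => c cE.
have cN : c < 2 * N + 2.
  by case: (cel a ltac:(lia)) => [|[/tl/lo h _]]; rewrite cE; lia.
no_overflow => v vE.
have lcat : l = take i l ++ o :: drop i.+1 l by rewrite -drop_nth // cat_take_drop.
(* By groupedness, an earlier pair with first vertex [u] means that the group of [u] is still
   open. *)
have gsp o' : o' \in take i l -> pair_fst o' = u -> pair_fst (last 0 (take i l)) = u.
  have : grouped (map pair_fst (take i l) ++ u :: map pair_fst (drop i.+1 l)).
    by rewrite -uo -map_cons -map_cat -lcat.
  move=> /grouped_split/orP h o'i o'u; case: h.
    have lst : last o (take i l) = last 0 (take i l) by move: o'i; case: (take i l).
    by rewrite -{1}uo last_map lst => /eqP.
  by move/mapP=> []; exists o'.
(* If the key of [o] has occurred, the cell holds its representative. If not, [o] represents itself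
   and the test fails: an empty cell has name 0, and a pair passing the test would have the key of
   [o]. *)
have cv : (if v == 1 then c else o) = rep l o /\ v <= 1.
  have vv : v = (m (2 * S + c %/ 2) == u) by [].
  split; last by rewrite vv; case: eqP.
  have [/mapP[o' o'i ko]|kn] := boolP (key o \in map key (take i l)).
    have uo' : pair_fst o' = u by rewrite -uo; exact: esym (congr1 fst ko).
    have ao' : pair_snd o' = a by rewrite -ao; exact: esym (congr1 snd ko).
    have crep : c = rep l o.
      rewrite cE -ao' celg //; first by rewrite /rep ko.
      by rewrite uo' (gsp o').
    have cl : c \in l by rewrite crep rep_in.
    have cf : pair_fst c = u by rewrite crep -uo; exact: (congr1 fst (key_rep ol)).
    rewrite vv ids; last by lia.
    by rewrite (ptN _ cl) -/(pair_fst c) cf eqxx.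
  have ro : rep l o = o.
    rewrite /rep {2}lcat map_cat index_cat (negbTE kn) /= eqxx addn0 size_map.
    by rewrite size_takel // ltnW.
  rewrite ro; case: eqP => // v1; case: (cel a ltac:(lia)) => [c0|[ci ca]].
    move: v1; rewrite vv cE c0 ids //; last by lia.
    by case: eqP => //= u0; lia.
  rewrite -cE in ci ca; case/negP: kn; apply/mapP; exists c => //.
  congr pair; last by rewrite ao.
  move: v1; rewrite vv ids; last by lia.
  by rewrite (ptN _ (tl _ ci)) uo; case: eqP.
have [cv1 v1] := cv; clear cv pE uE aE vE.
have selE : v * c + (1 - v) * o = rep l o.
  by rewrite -cv1; case: eqP => [->|vn]; last (have -> : v = 0 by lia); lia.
no_overflow; rewrite selE => d dE.
have dl : d \in l by rewrite dE rep_in.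
have dN := lo d dl.
no_overflow => m1 m1E; no_overflow => m2 m2E.
have szt : size (take i l) <= 2 * N by rewrite -szl size_take; case: ifP => //; lia.
have m2d : m2 (6 * S + d) = count (fun o => rep l o == d) (take i l).
  rewrite m2E ifF; last by lia.
  rewrite m1E ifF; last by lia.
  by rewrite cnts //; lia.
have := leq_trans (count_size (fun o => rep l o == d) (take i l)) szt.
rewrite -m2d => m2N; no_overflow => m3 m3E.
have m3u : m3 (7 * S + u) = count (fun o => pair_fst o == u) (take i l).
  rewrite m3E ifF; last by lia.
  rewrite m2E ifF; last by lia.
  rewrite m1E ifF; last by lia.
  by rewrite tcs //; lia.
have := leq_trans (count_size (fun o => pair_fst o == u) (take i l)) szt.
rewrite -m3u => m3N; no_overflow => m4 m4E; no_overflow.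
have m4o b : b != 4 * S + a -> b != 5 * S + o -> b != 6 * S + d -> b != 7 * S + u ->
    m4 b = m b.
  by move=> h1 h2 h3 h4; rewrite m4E m3E m2E m1E !ifF //; apply: negbTE.
have m4c : m4 (4 * S + a) = d.
  rewrite m4E ifF; last by lia.
  rewrite m3E ifF; last by lia.
  rewrite m2E ifF; last by lia.
  by rewrite m1E eqxx.
have m4r : m4 (5 * S + o) = d.
  rewrite m4E ifF; last by lia.
  rewrite m3E ifF; last by lia.
  by rewrite m2E eqxx.
have m4d : m4 (6 * S + d) = m2 (6 * S + d) + 1.
  rewrite m4E ifF; last by lia.
  by rewrite m3E eqxx.
have m4u : m4 (7 * S + u) = m3 (7 * S + u) + 1 by rewrite m4E eqxx.
have takeS : take i.+1 l = rcons (take i l) o by rewrite (take_nth 0).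
move=> o1 o1E; no_overflow => i' i'E; split.
  split=> //.
  - by rewrite /= i'E addn1.
  - rewrite /= o1E m4o; try lia.
    exact: linked_nth.
  - by split=> b bb; rewrite m4o ?labs ?ids //; lia.
  - split=> //; apply: fpath_eq_in lk => b; rewrite belast_rcons inE => bl.
    have bN : b < 2 * N + 2 by case/orP: bl => [/eqP->|/lo]; lia.
    by rewrite m4o //; lia.
rewrite takeS; split.
- move=> b; rewrite mem_rcons inE => /orP[/eqP->|bi]; first by rewrite m4r.
  have [->|bo] := eqVneq b o; first by rewrite m4r.
  by have := lo b (tl b bi) => bN; rewrite m4o ?refs //; lia.
- move=> b bS; rewrite -cats1 count_cat /= addn0.
  have [->|bd] := eqVneq b d; first by rewrite m4d m2d -dE eqxx.
  by rewrite m4o ?cnts -?dE 1?eq_sym ?(negbTE bd) ?addn0 //; lia.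
- move=> b bS; rewrite -cats1 count_cat /= addn0 uo.
  have [->|bd] := eqVneq b u; first by rewrite m4u m3u.
  by rewrite m4o ?tcs ?addn0 //; lia.
- move=> b bS; rewrite mem_rcons inE; have [->|ba] := eqVneq b a.
    rewrite m4c; right; split; last by rewrite dE -ao; exact: (congr1 snd (key_rep ol)).
    move: cv1; rewrite -dE; case: eqP => [_|_] cd; last by rewrite cd eqxx.
    case: (cel a ltac:(lia)) => [c0|[ci _]]; first by lia.
    by rewrite -cd cE ci orbT.
  rewrite m4o; try lia.
  by case: (cel b bS) => [->|[bi bs]]; [left|right; rewrite bi orbT].
- move=> b; rewrite mem_rcons last_rcons inE uo => bo bu.
  have [ba|ba] := eqVneq (pair_snd b) a.
    rewrite ba m4c dE /rep; congr nth; congr index.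
    by rewrite /key uo ao bu ba.
  have bl : b \in l by case/orP: bo => [/eqP->|/tl].
  have sN : pair_snd b < S.
    have := name_bounds (other_bounds (b %% 2) (ptN b bl)).
    by have := other_bounds (b %% 2) (ptN b bl); rewrite -/(pair_snd b); lia.
  rewrite m4o; try lia.
  case/orP: bo => [/eqP e|bi]; first by rewrite e ao eqxx in ba.
  by rewrite celg // bu (gsp b).
Qed.

Definition pair_cmds : seq cmd :=
  map Do [:: 3 ::= #0; 5 ::= cell 3 #0] ++ [:: Loop 3 2 pair_body].

Definition pair_time : nat := size (compile_body [:: 3 ::= #0; 5 ::= cell 3 #0]) +
  (2 * N * (size (compile_body pair_body) + 3) + 2).

Definition pair_total (l : seq nat) (o : nat) := count (fun o' => key o' == key o) l.
Definition vertex_total (l : seq nat) (u : nat) := count (fun o => pair_fst o == u) l.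

Definition counted (l : seq nat) (m : nat -> nat) :=
  [/\ uniq l, l =i iota 2 (2 * N),
      forall o, o \in l -> m (5 * S + o) = rep l o,
      forall o, o \in l -> m (6 * S + rep l o) = pair_total l o &
      forall u, u < S -> m (7 * S + u) = vertex_total l u].

Lemma pair_correct :
  triple w (link_inv (2 * N)) pair_cmds pair_time
    (fun r m => [/\ sized r, named_mem m & exists l, counted l m]).
Proof.
(* The list is final now, so it can be fixed as a parameter of the loop invariant. *)
apply: (@triple_weaken w (fun r m => exists l,
  [/\ sized r, named_mem m, pair_list l m &
    forall a, 4 * S <= a < 8 * S -> m a = 0])) (fun _ _ h => h) _.
  by move=> r m [sr _ nm zero [l pl]]; exists l.
apply: triple_exists => l.
apply: (triple_cat (B := pair_inv l 0)).
  apply: triple_do => // r m [[r0 r1 r2] nm pl zero].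
  rewrite /= /upd /= r1; no_overflow => i ->; no_overflow => o ->.
  split; first split=> //=.
    by have [_ _ /pathP-/(_ 0 0) + _] := pl; rewrite size_rcons => /(_ isT)/eqP/= ->;
      case: (l).
  rewrite take0; split=> //.
  - by move=> c cS; rewrite zero //; lia.
  - by move=> c cS; rewrite zero //; lia.
  - by move=> a aS; left; rewrite zero //; lia.
apply: (@triple_weaken w (pair_inv l 0) _ (pair_inv l (2 * N))) => //; last first.
  apply: triple_loop => //; first by move=> j r m [[[]]].
  by move=> j r m jN; apply: pair_body_correct.
move=> r m [[sr _ _ nm pl] [refs cnts tcs _ _]]; split=> //; exists l.
have szl := pair_list_size pl; have [ul li _ _] := pl.
rewrite take_oversize ?szl // in refs cnts tcs.
split=> // o ol; rewrite cnts.
  by apply: eq_in_count => o' o'l; apply: rep_eq.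
by have := rep_in ol; rewrite li mem_iota /S /N; lia.
Qed.

(** * Output of the edges *)

(** The first condition is adjacency by [adj_lex]; the second keeps one copy of each ordered pair,
    the third one of its two orientations. *)
Definition emit (l : seq nat) (o : nat) : bool :=
  let p := o %/ 2 in let s := o %% 2 in
  let pa := other p s in let pb := other p (1 - s) in
  [&& ~~ (lex (pair_total l o) (vertex_total l (name pb))
              (pair_total l (2 * p + (1 - s))) (vertex_total l (name pa)) &&
          lex (pair_total l o) (vertex_total l (name pb))
              (pair_total l (2 * pa + s)) (vertex_total l (name p))),
      rep l o == o & lab p < lab pa].

Definition emitted l i := [seq o <- iota 2 i | emit l o].

Definition emit_inv (l : seq nat) (i : nat) : assertion := fun r m =>
  [/\ sized r, r 3 = i, r 4 = size (emitted l i), named_mem m & counted l m] /\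
  forall j, j < size (emitted l i) ->
    m (2 * j + 1) = lab (nth 0 (emitted l i) j %/ 2) /\
    m (2 * j + 2) = lab (other (nth 0 (emitted l i) j %/ 2) (nth 0 (emitted l i) j %% 2)).

Lemma lex_natE s1 t1 s2 t2 : (s1 < s2) + (s1 == s2) * (t1 < t2) = lex s1 t1 s2 t2.
Proof. by rewrite /lex; case: (ltngtP s1 s2) => //= _; case: (t1 < t2). Qed.

Lemma emitted_size l i : size (emitted l i) <= i.
Proof. by rewrite size_filter -{2}(size_iota 2 i) count_size. Qed.

(** The output overwrites the input, whose labels were copied to array 1. At most [2 * N] edges
    reach up to cell [4 * N], which is below [S = 5 * N]. *)
Lemma emit_body_correct l i r m : i < 2 * N ->
  emit_inv l i r m -> wp w emit_body (emit_inv l i.+1) r m.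
Proof.
move=> iN [[[r0 r1 r2] r3 r4 [labs ids] cm] out].
have [ul li refs cnts tcs] := cm.
have lo a : (a \in l) = (1 < a < 2 * N + 2) by rewrite li mem_iota; lia.
have szl : size l = 2 * N.
  by rewrite -(size_iota 2 (2 * N)); apply: perm_size; apply: uniq_perm; rewrite ?iota_uniq.
have refS a : 1 < a < 2 * N + 2 -> rep l a < 2 * N + 2.
  by rewrite -lo => /rep_in; rewrite lo => /andP[].
have cN (f : pred nat) : count f l <= 2 * N by rewrite -szl count_size.
have ptN a : a \in l -> 0 < a %/ 2 <= N by rewrite lo; lia.
set e := size (emitted l i) in r4 out.
have ei : e <= i := emitted_size l i.
rewrite /= /upd /= r1 r3 r4; no_overflow => o oE; no_overflow => p pE; no_overflow => s sE.
have oo : 1 < o < 2 * N + 2 by lia.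
have pN : 0 < p <= N by lia.
have s1 : s <= 1 by lia.
have opN := other_bounds s pN.
have opN' := other_bounds (1 - s) pN.
no_overflow => pa paE; no_overflow => pb pbE.
rewrite -/(other p s) in paE; rewrite -/(other p (1 - s)) in pbE.
rewrite -paE in opN; rewrite -pbE in opN'.
have nN q : 0 < q <= N -> name q <= N by move=> qN; have := name_bounds qN; lia.
have labw q : 0 < q <= N -> lab q < 2 ^ w.
  by move=> qN; apply: xsw; apply: mem_nth; rewrite xsN; lia.
set q2 := 2 * p + (1 - s); set q3 := 2 * pa + s.
(* The facts quantified over [unit] are hidden from [lia] in this way. *)
have emitE (_ : unit) : emit l o = [&& ~~ (lex (pair_total l o) (vertex_total l (name pb))
    (pair_total l q2) (vertex_total l (name pa)) &&
    lex (pair_total l o) (vertex_total l (name pb))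
    (pair_total l q3) (vertex_total l (name p))), rep l o == o & lab p < lab pa].
  by rewrite /emit -pE -sE -paE -pbE.
have ol : o \in l by rewrite lo.
have q2l : q2 \in l by rewrite lo /q2; lia.
have q3l : q3 \in l by rewrite lo /q3; lia.
have oR := refS o oo.
have q2R : rep l q2 < 2 * N + 2 by apply: refS; rewrite -lo.
have q3R : rep l q3 < 2 * N + 2 by apply: refS; rewrite -lo.
have q2N : q2 < 2 * N + 2 by rewrite /q2; lia.
have q3N : q3 < 2 * N + 2 by rewrite /q3; lia.
have nS q : 0 < q <= N -> name q < S by move=> /nN; lia.
rewrite (refs o ol) (refs q2 q2l) (refs q3 q3l).
rewrite (cnts o ol) (cnts q2 q2l) (cnts q3 q3l).
rewrite !ids; try lia.
rewrite pN opN opN' (tcs _ (nS _ pN)) (tcs _ (nS _ opN)) (tcs _ (nS _ opN')).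
rewrite (labs _ pN) (labs _ opN).
have [n1 n2 n3] := And3 (nN _ pN) (nN _ opN) (nN _ opN').
have [w1 w2] := conj (labw _ pN) (labw _ opN).
have emS (_ : unit) : emitted l i.+1 = if emit l o then rcons (emitted l i) o else emitted l i.
  rewrite /emitted -[i.+1]addn1 iotaD filter_cat /= addnC -oE -cats1.
  by case: (emit l o); rewrite ?cats0.
have eN : e <= 2 * N by lia.
have outE (_ : unit) : p = o %/ 2 /\ pa = other (o %/ 2) (o %% 2) by rewrite -pE -sE.
clear pE sE paE pbE szl ol q2l q3l ei; clearbody q2 q3.
no_overflow => y10 y10E; no_overflow => y11 y11E; no_overflow => y12 y12E.
no_overflow => y13 y13E; no_overflow => y14 y14E; no_overflow => y15 y15E.
have w2' : 2 < 2 ^ w by lia.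
have blt (b : bool) : b < 2 ^ w by case: b; lia.
have bmul (b c : bool) : b * c = b && c by case: b; case: c.
rewrite !lex_natE !bmul; do 3! split=> //; do 2! (split; first exact: blt).
move=> f1 f1E; do 3! split=> //; do 2! (split; first exact: blt).
move=> f2 f2E; no_overflow => f3 f3E; no_overflow => f4 f4E.
have fE : (1 - f1 * f2) * (f3 * f4) = emit l o.
  rewrite f1E f2E f3E f4E (emitE tt) y10E y11E y12E y13E y14E y15E !bmul.
  by case: (_ && _); case: (_ && _).
have f12 : f1 * f2 <= 1 by rewrite f1E f2E bmul; case: (_ && _).
have f34 : f3 * f4 <= 1 by rewrite f3E f4E bmul; case: (_ && _).
clear f1E f2E f3E f4E y10E y11E y12E y13E y14E y15E.
rewrite fE; do 5! (split; first by [lia | case: (emit l o); lia]).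
move=> f fb; no_overflow.
move=> m1 m1E; no_overflow.
have m1pa : m1 (1 * S + pa) = lab pa.
  by rewrite m1E ifF ?labs //; lia.
rewrite m1pa => m2 m2E; have f1' : f <= 1 by rewrite fb; case: (emit l o).
no_overflow => e' e'E; no_overflow => i' i'E.
have m2o b : b != 2 * e + 1 -> b != 2 * e + 2 -> m2 b = m b.
  by move=> h1 h2; rewrite m2E m1E !ifF //; apply: negbTE.
split.
  split=> //; first by rewrite /= i'E addn1.
  - by rewrite /= e'E emS //; move: fb; case: (emit l o) => ->; rewrite ?size_rcons /=; lia.
  - by split=> b bb; rewrite m2o ?labs ?ids //; lia.
  - split=> // b bb.
    + by rewrite m2o ?refs //; move: bb; rewrite lo; lia.
    + rewrite m2o ?cnts //; lia.
    + by rewrite m2o ?tcs //; lia.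
(* A rejected candidate lies beyond the counted edges, so it does not affect them. *)
rewrite emS //; case: (boolP (emit l o)) => _ j; rewrite ?size_rcons -/e => je; last first.
  by rewrite !m2o; try exact: out; lia.
rewrite nth_rcons; rewrite -/e; have [jl|jl] := ltnP j e.
  by rewrite !m2o; try exact: out; lia.
have -> : j = e by lia.
have [eP eA] := outE tt; rewrite eqxx -eA -eP; split.
  by rewrite m2E ifF; [rewrite m1E eqxx | lia].
by rewrite m2E eqxx.
Qed.

Definition emit_cmds : seq cmd :=
  map Do [:: 3 ::= #0; 4 ::= #0] ++ [:: Loop 3 2 emit_body] ++ map Do [:: #0 <~ $4].

Definition emit_time : nat := size (compile_body [:: 3 ::= #0; 4 ::= #0]) +
  (2 * N * (size (compile_body emit_body) + 3) + 2 + size (compile_body [:: #0 <~ $4])).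

Definition reconstructed (m : nat -> nat) := exists l,
  [/\ uniq l, l =i iota 2 (2 * N), m 0 = size (emitted l (2 * N)) &
    forall j, j < size (emitted l (2 * N)) ->
      let o := nth 0 (emitted l (2 * N)) j in
      m (2 * j + 1) = lab (o %/ 2) /\ m (2 * j + 2) = lab (other (o %/ 2) (o %% 2))].

Lemma emit_correct :
  triple w (fun r m => [/\ sized r, named_mem m & exists l, counted l m])
    emit_cmds emit_time (fun _ m => reconstructed m).
Proof.
apply: (@triple_weaken w (fun r m => exists l,
  [/\ sized r, named_mem m & counted l m])) (fun _ _ h => h) _.
  by move=> r m [sr nm [l cl]]; exists l.
apply: triple_exists => l.
apply: (triple_cat (B := emit_inv l 0)).
  apply: triple_do => // r m [[r0 r1 r2] nm cl].
  by rewrite /= /upd /=; no_overflow => i ->; no_overflow => e ->; split.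
apply: (triple_cat (B := emit_inv l (2 * N))).
  apply: triple_loop => //; first by move=> j r m [[[]]].
  by move=> j r m jN; apply: emit_body_correct.
apply: triple_do => // r m [[_ _ r4 _ [ul li _ _ _]] out].
rewrite /= /upd /= r4; no_overflow => m' m'E; exists l; split=> //.
  by rewrite m'E.
by move=> j je /=; rewrite m'E !ifF; try exact: out; lia.
Qed.

Definition reconstruction : seq cmd := name_cmds ++ link_cmds ++ pair_cmds ++ emit_cmds.

Lemma reconstruction_correct :
  triple w (fun r m => m =1 nth 0 (T :: xs)) reconstruction (41 * 100 * T)
    (fun _ m => reconstructed m).
Proof.
(* There are at most [4002 * T + 65] steps. *)
have time : name_time + (link_time + (pair_time + emit_time)) <= 41 * 100 * T.
  rewrite /name_time /link_time /pair_time /emit_time.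
  have -> : size (compile_body setup) = 24 by [].
  have -> : size (compile_body name_body) = 121 by [].
  have -> : size (compile_body link_body) = 64 by [].
  have -> : size (compile_body pair_body) = 162 by [].
  have -> : size (compile_body emit_body) = 308 by [].
  by rewrite /=; lia.
move=> P pre post r r' m defP ag pr.
have := triple_cat name_correct (triple_cat link_correct
  (triple_cat pair_correct emit_correct)).
move=> /(_ P pre post r r' m defP ag pr) [k [r2 [r2' [m2 [kt s2 ag2 q2]]]]].
by exists k, r2, r2', m2; split=> //; apply: leq_trans time.
Qed.
End Machine.

(** * Correctness of the output *)

Lemma nth_flatten_uniform (A B : Type) (f : A -> seq B) n s x0 y0 i :
  (forall x, size (f x) = n) -> i < n * size s ->
  nth y0 (flatten (map f s)) i = nth y0 (f (nth x0 s (i %/ n))) (i %% n).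
Proof.
move=> fn; have [->|n0] := posnP n; first by rewrite mul0n.
elim: s i => [|x s IH] i /=; first by rewrite muln0.
rewrite mulnS nth_cat fn => ins; have [lt|ge] := ltnP i n.
  by rewrite divn_small // modn_small.
rewrite IH; last by rewrite ltn_subLR.
have -> : i %/ n = ((i - n) %/ n).+1.
  by rewrite -{1}(subnK ge) divnDr ?dvdnn // divnn n0 addn1.
by have -> : i %% n = (i - n) %% n by rewrite -{1}(subnK ge) modnDr.
Qed.

Lemma size_flatten_uniform (A B : Type) (f : A -> seq B) n s :
  (forall x, size (f x) = n) -> size (flatten (map f s)) = n * size s.
Proof.
move=> fn; elim: s => [|x s IH] /=; first by rewrite muln0.
by rewrite size_cat IH fn mulnS.
Qed.

Lemma count_fst (A B : finType) (v : A) (s : seq (A * B)) :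
  count (fun k => k.1 == v) s = \sum_x count_mem (v, x) s.
Proof.
elim: s => [|[a b] s IH] /=; first by rewrite big1.
rewrite big_split /= -IH; congr (_ + _).
rewrite (bigD1 b) //= big1 ?addn0 ?xpair_eqE ?eqxx ?andbT // => x xb.
by rewrite xpair_eqE (eq_sym b) (negbTE xb) andbF.
Qed.

(** The order of this list matches the numbering of the ordered pairs by [2 * p + s]. *)
Definition orders (A : Type) (t : A * A * A) : seq (A * A * A) :=
  let: (x, y, z) := t in
  [:: (x, y, z); (x, z, y); (y, z, x); (y, x, z); (z, x, y); (z, y, x)].

Section Reconstruction.
Variables (w : nat) (G : sgraph) (label : G -> 'I_(2 ^ w)) (ts : seq (G * G * G)).
Let T := size ts.
Let N := 3 * T.
Definition members (t : G * G * G) : seq G := [:: t.1.1; t.1.2; t.2].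
Definition input_vertices : seq G := flatten (map members ts).
Definition input_labels : seq nat := [seq val (label v) | v <- input_vertices].

Lemma triples_wordsE : triples_words label ts = T :: input_labels.
Proof.
congr cons; rewrite /input_labels /input_vertices map_flatten -map_comp.
by congr flatten; apply: eq_map.
Qed.

Lemma size_input_labels : size input_labels = N.
Proof. by rewrite size_map (@size_flatten_uniform _ _ _ 3). Qed.

Variable v0 : G.
Local Notation ilab := (lab input_labels).
Local Notation iname := (name input_labels).
Local Notation ikey := (key input_labels).
Local Notation irep := (rep input_labels).

Definition vtx (p : nat) : G := nth v0 input_vertices p.-1.

Lemma labE p : 0 < p <= N -> ilab p = label (vtx p).
Proof.
move=> pN; rewrite /lab (nth_map v0) //.
by rewrite -(size_map (fun v => val (label v))) size_input_labels; lia.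
Qed.

Definition ordered (o : nat) : G * G * G :=
  (vtx (o %/ 2), vtx (other (o %/ 2) (o %% 2)), vtx (other (o %/ 2) (1 - o %% 2))).

Lemma vtxE k j : k < T -> j < 3 ->
  vtx (3 * k + j).+1 = nth v0 (members (nth (v0, v0, v0) ts k)) j.
Proof.
move=> kT j3; rewrite /vtx /= (@nth_flatten_uniform _ _ _ 3 _ (v0, v0, v0)) //; last first.
  by rewrite -/T; lia.
by have [-> ->] : (3 * k + j) %/ 3 = k /\ (3 * k + j) %% 3 = j by lia.
Qed.

(** Each triple owns six consecutive pair numbers, so index arithmetic reduces the claim to six
    remainders. *)
Lemma map_ordered : map ordered (iota 2 (2 * N)) = flatten (map (@orders G) ts).
Proof.
have so (t : G * G * G) : size (orders t) = 6 by case: t => [[]].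
have sf : size (flatten (map (@orders G) ts)) = 2 * N.
  by rewrite (@size_flatten_uniform _ _ _ 6) // -/T /N; lia.
apply: (@eq_from_nth _ (v0, v0, v0)); rewrite size_map size_iota ?sf // => i iN.
rewrite (nth_map 0) ?size_iota // nth_iota //.
rewrite (@nth_flatten_uniform _ _ _ 6 _ (v0, v0, v0)) //; last by rewrite -/T; lia.
set k := i %/ 6; have kT : k < T by rewrite /k; lia.
have vk j := @vtxE k j kT.
have c6 : i %% 6 < 6 by lia.
rewrite /ordered; move: c6 (erefl (i %% 6)) vk; move: {-2}(i %% 6) => c.
case: (nth _ ts k) => [[x y] z] /=.
have pE a b : a = b -> vtx a = vtx b by move->.
case: c => [|[|[|[|[|[|//]]]]]] _ ci vk /=; congr (_, _, _);
  match goal with |- _ = ?r => first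
   [ rewrite -[r](vk 0) //; apply: pE; rewrite /other /k; lia
   | rewrite -[r](vk 1) //; apply: pE; rewrite /other /k; lia
   | rewrite -[r](vk 2) //; apply: pE; rewrite /other /k; lia ] end.
Qed.

Hypothesis conn : connected_graph G.
Hypothesis tfree : triangle_free G.
Hypothesis card5 : 5 <= #|G|.
Hypothesis label_inj : injective label.
Hypothesis tsP : lists_triples ts.

Lemma size_ts : T = #|connected_triples G|.
Proof.
by rewrite /T cardE -(perm_size tsP) size_map.
Qed.

Lemma T_gt1 : 1 < T.
Proof. by rewrite size_ts card_connected_triples_gt1. Qed.

Lemma name_eq p q : 0 < p <= N -> 0 < q <= N -> (iname p == iname q) = (vtx p == vtx q).
Proof.
move=> pN qN; rewrite /name /first_pos eqSS.
have inl r : 0 < r <= N -> ilab r \in input_labels.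
  by move=> rN; apply: mem_nth; rewrite size_input_labels; lia.
apply/eqP/eqP => [e|e]; last by rewrite !labE ?e.
have : ilab p = ilab q.
  by rewrite -(nth_index 0 (inl p pN)) e nth_index // inl.
by rewrite !labE // => /val_inj/label_inj.
Qed.

Definition pairs : seq (G * G) := [seq t.1 | t <- flatten (map (@orders G) ts)].

(** A triple contributes [(u, a)] once if it contains these two distinct vertices, and never
    otherwise; such triples correspond to their third vertices. *)
Lemma count_pairs u a : count_mem (u, a) pairs = pair_count u a.
Proof.
pose C (A : {set G}) := [&& u != a, u \in A & a \in A].
have -> : count_mem (u, a) pairs = count C (enum (connected_triples G)).
  rewrite -(permP tsP) /pairs map_flatten -map_comp count_flatten -map_comp count_map.
  have sub : all (fun t : G * G * G => #|[set t.1.1; t.1.2; t.2]| == 3) ts.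
    apply/allP => t tin.
    have : [set t.1.1; t.1.2; t.2] \in enum (connected_triples G).
      by rewrite -(perm_mem tsP); apply: map_f.
    by rewrite mem_enum inE => /andP[].
  elim: (ts) sub => //= [[[x y] z] s] IH /andP[c3 /IH <-]; congr (_ + _).
  have : [&& x != y, y != z & x != z].
    move: c3; rewrite /= -setUA cardsU1 cards2 !inE negb_or.
    by case: (x == y); case: (y == z); case: (x == z).
  case/and3P=> xy yz xz; rewrite /= !xpair_eqE /C !inE.
  have [yx zy zx] : [/\ y != x, z != y & z != x] by rewrite !(eq_sym z) (eq_sym y).
  rewrite !(eq_sym _ u) !(eq_sym _ a).
  have [eu|ux] := eqVneq u x; [|have [eu|uy] := eqVneq u y;
    [|have [eu|uz] := eqVneq u z]];
  (have [ea|ax] := eqVneq a x; [|have [ea|ay] := eqVneq a y;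
    [|have [ea|az] := eqVneq a z]]);
  by rewrite ?eu ?ea ?eqxx ?(negbTE xy) ?(negbTE yx) ?(negbTE xz) ?(negbTE zx)
    ?(negbTE yz) ?(negbTE zy) ?andbF.
have -> : count C (enum (connected_triples G)) =
    #|[set A in connected_triples G | C A]|.
  rewrite -size_filter cardE; apply: perm_size; apply: uniq_perm.
  - by rewrite filter_uniq ?enum_uniq.
  - exact: enum_uniq.
  - by move=> A; rewrite mem_filter !mem_enum [RHS]in_set andbC.
have [e|ua] := eqVneq u a.
  rewrite e pair_count_refl; apply: eq_card0 => A; rewrite !inE /C e eqxx.
  by rewrite andbF.
rewrite /pair_count; have -> : [set A in connected_triples G | C A] =
    [set [set u; a; x] | x in [set x | trip u a x]].
  apply/setP=> A; rewrite [LHS]in_set; apply/andP/imsetP => [[At /and3P[_ uA aA]]|[x]].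
    have : #|A| == 3 by move: At; rewrite inE => /andP[].
    rewrite (cardsD1 u) uA (cardsD1 a) !inE (eq_sym a u) ua aA !add1n !eqSS => /cards1P[x xE].
    have AE : A = [set u; a; x].
      by rewrite -(setD1K uA) -(@setD1K _ a (A :\ u)) ?xE ?setUA // !inE (eq_sym a u) ua.
    by exists x => //; rewrite inE /trip -AE.
  by rewrite inE => xt ->; split=> //; rewrite /C ua !inE !eqxx !orbT.
rewrite card_in_imset // => x y; rewrite !inE => xt yt e.
move: xt; rewrite tripE => /and4P[_ ax ux _].
have : x \in [set u; a; y] by rewrite -e !inE eqxx orbT.
by rewrite !inE (eq_sym x u) (negbTE ux) (eq_sym x a) (negbTE ax) => /eqP.
Qed.

Lemma count_pairs_fst v : count (fun k => k.1 == v) pairs = vertex_count v.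
Proof. by rewrite count_fst; apply: eq_bigr => x _; apply: count_pairs. Qed.

Lemma map_ordered_fst : map (fun o => (ordered o).1) (iota 2 (2 * N)) = pairs.
Proof. by rewrite /pairs -map_ordered -map_comp. Qed.

Section List.
Variable l : seq nat.
Hypothesis ul : uniq l.
Hypothesis li : l =i iota 2 (2 * N).

Lemma mem_list o : (o \in l) = (1 < o < 2 * N + 2).
Proof. by rewrite li mem_iota; lia. Qed.

Lemma perm_list : perm_eq l (iota 2 (2 * N)).
Proof. by apply: uniq_perm; rewrite ?iota_uniq. Qed.

Lemma other_le p s : 0 < p <= N -> 0 < other p s <= N.
Proof. by rewrite /other /N; lia. Qed.

Lemma pos_le o : o \in l -> 0 < o %/ 2 <= N.
Proof. by rewrite mem_list; lia. Qed.

Lemma key_eq o o' : o \in l -> o' \in l ->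
  (ikey o == ikey o') = ((ordered o).1 == (ordered o').1).
Proof.
move=> ol ol'; rewrite /key /ordered !xpair_eqE /=.
by rewrite !name_eq ?other_le ?pos_le.
Qed.

Lemma pair_totalE o : o \in l ->
  pair_total input_labels l o = pair_count (ordered o).1.1 (ordered o).1.2.
Proof.
move=> ol; rewrite -count_pairs -map_ordered_fst count_map -(permP perm_list).
by apply: eq_in_count => o' ol' /=; rewrite key_eq // -surjective_pairing.
Qed.

Lemma vertex_totalE p : 0 < p <= N ->
  vertex_total input_labels l (iname p) = vertex_count (vtx p).
Proof.
move=> pN; rewrite -count_pairs_fst -map_ordered_fst count_map -(permP perm_list).
by apply: eq_in_count => o' ol' /=; rewrite name_eq // pos_le.
Qed.

Lemma ordered_trip o : o \in l ->
  trip (ordered o).1.1 (ordered o).1.2 (ordered o).2.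
Proof.
rewrite li => /(map_f ordered); rewrite map_ordered.
move: (ordered o) => q /flatten_mapP[t tin].
have : [set t.1.1; t.1.2; t.2] \in connected_triples G.
  by rewrite -mem_enum -(perm_mem tsP); apply: map_f.
case: t {tin} => [[x y] z] /= tt.
have txyz : trip x y z by [].
rewrite !inE => /or4P[|||/or3P[]] /eqP-> //=.
- by rewrite trip_swap23.
- by rewrite trip_swap23 trip_swap12.
- by rewrite trip_swap12.
- by rewrite trip_swap12 trip_swap23.
- by rewrite trip_swap12 trip_swap23 trip_swap12.
Qed.

(** For [o = 2 * p + s], the numbers [2 * p + (1 - s)] and [2 * other p s + s] denote the pairs
    formed by each vertex of [o] with the third one, as [adj_lex] requires. *)
Lemma emitE o : o \in l -> emit input_labels l o =
  [&& adj (ordered o).1.1 (ordered o).1.2, irep l o == o &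
    label (ordered o).1.1 < label (ordered o).1.2].
Proof.
move=> ol; have pN := pos_le ol.
have := other_le (o %% 2) pN; have := other_le (1 - o %% 2) pN => bN aN.
rewrite /emit !labE // !vertex_totalE // (adj_lex conn tfree card5 (ordered_trip ol)).
set p := o %/ 2 in pN aN bN *; set s := o %% 2 in aN bN *.
have s1 : s <= 1 by rewrite /s; lia.
have q2l : 2 * p + (1 - s) \in l by rewrite mem_list; lia.
have q3l : 2 * other p s + s \in l by rewrite mem_list; lia.
rewrite !pair_totalE //.
have -> : (ordered (2 * p + (1 - s))).1 = (vtx p, vtx (other p (1 - s))).
  have [e1 e2] : (2 * p + (1 - s)) %/ 2 = p /\ (2 * p + (1 - s)) %% 2 = 1 - s by lia.
  by rewrite /ordered e1 e2.
have -> // : (ordered (2 * other p s + s)).1 = (vtx (other p s), vtx (other p (1 - s))).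
have [e1 e2] : (2 * other p s + s) %/ 2 = other p s /\ (2 * other p s + s) %% 2 = s by lia.
rewrite /ordered e1 e2 /=; congr (_, vtx _).
by rewrite /other; clear -pN s1; lia.
Qed.

Definition edges : seq (G * G) := [seq (ordered o).1 | o <- emitted input_labels l (2 * N)].

Lemma mem_emitted o : (o \in emitted input_labels l (2 * N)) =
  (o \in l) && emit input_labels l o.
Proof. by rewrite mem_filter -li andbC. Qed.

Lemma edges_listed : lists_edges edges.
Proof.
apply: uniq_perm; last 1 first.
- move=> A; rewrite mem_enum -map_comp; apply/mapP/imsetP => [[o]|[[x y]]].
    rewrite mem_emitted => /andP[ol]; rewrite emitE // => /and3P[xy _ _] ->.
    by exists (ordered o).1; rewrite ?inE.
  rewrite inE /= => xy ->.
  wlog lxy : x y xy / label x < label y.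
    move=> h; have [lt|gt|] := ltngtP (label x) (label y); first exact: h.
      by rewrite setUC; apply: h; rewrite 1?adj_sym.
    by move/val_inj/label_inj => e; rewrite e adj_irr in xy.
  (* Some triple contains the edge, so [(x, y)] is among the listed pairs, and its representative is
     emitted. *)
  have [z xyz] := edge_in_trip conn card5 xy.
  have : 0 < count_mem (x, y) pairs.
    by rewrite count_pairs; apply/card_gt0P; exists z; rewrite inE.
  rewrite -has_count has_pred1 -map_ordered_fst => /mapP[o]; rewrite -li => ol oxy.
  have rl := rep_in input_labels ol.
  have ro : (ordered (irep l o)).1 = (x, y).
    by rewrite oxy; apply/eqP; rewrite -key_eq // key_rep.
  exists (irep l o); last by case: ro => -> ->.
  rewrite mem_emitted rl emitE // ro xy lxy /= andbT.
  by rewrite rep_eq ?rep_in // key_rep.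
- rewrite -map_comp map_inj_in_uniq ?filter_uniq ?iota_uniq // => o o'.
  rewrite !mem_emitted => /andP[ol] + /andP[ol'].
  rewrite !emitE // => /and3P[_ /eqP ro lt] /and3P[_ /eqP ro' lt'] e.
  have {}e : [set (ordered o).1.1; (ordered o).1.2] =
    [set (ordered o').1.1; (ordered o').1.2] := e.
  (* Increasing labels orient each edge uniquely, and an ordered pair has a single
     representative. *)
  rewrite -ro -ro'; apply/eqP; rewrite rep_eq // key_eq //.
  move: (ordered o).1 (ordered o').1 lt lt' e => [x y] [x' y'] /= lt lt' /setP e.
  have := e x; have := e y; rewrite !inE !eqxx ?orbT /=.
  move=> /esym/orP[] /eqP ey /esym/orP[] /eqP ex; rewrite ey ex ?ltnn // in lt *.
  by have := ltn_trans lt lt'; rewrite ltnn.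
- exact: enum_uniq.
Qed.
End List.
End Reconstruction.

Lemma reconstructed_outputs w (G : sgraph) (label : G -> 'I_(2 ^ w))
    (ts : seq (G * G * G)) (s : state) :
  connected_graph G -> triangle_free G -> 5 <= #|G| -> injective label ->
  lists_triples ts -> reconstructed (size ts) (input_labels label ts) (memory s) ->
  outputs_edges label s.
Proof.
move=> conn tfree card5 linj tsP [l [ul li m0 out]].
have [v0 _] : exists v0 : G, v0 \in [set: G].
  by apply/card_gt0P; rewrite cardsT (leq_trans _ card5).
exists (edges label ts v0 l); first exact: edges_listed.
have sE : size (edges label ts v0 l) =
    size (emitted (input_labels label ts) l (2 * (3 * size ts))) by rewrite size_map.
case=> [|i]; rewrite /edges_words /=; first by rewrite m0 sE.
rewrite ltnS (@size_flatten_uniform _ _ _ 2) // sE => iS.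
rewrite (@nth_flatten_uniform _ _ _ 2 _ (v0, v0)) ?sE //.
set j := i %/ 2; have jS : j < size (emitted (input_labels label ts) l (2 * (3 * size ts))).
  by rewrite /j; lia.
rewrite (nth_map 0) //; set o := nth 0 _ j; have [o1 o2] := out j jS.
have : o \in emitted (input_labels label ts) l (2 * (3 * size ts)) by rewrite mem_nth.
rewrite mem_emitted // => /andP[ol _]; have pN : 0 < o %/ 2 <= 3 * size ts.
  by move: ol; rewrite li mem_iota; lia.
have aN : 0 < other (o %/ 2) (o %% 2) <= 3 * size ts by rewrite /other; lia.
have [i2|i2] : i %% 2 = 0 \/ i %% 2 = 1 by lia.
  by rewrite i2 /= -(labE label v0 pN) -o1; congr (memory s _); rewrite /j; lia.
by rewrite i2 /= -(labE label v0 aN) -o2; congr (memory s _); rewrite /j; lia.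
Qed.

(** * Halting and running time on the machine *)

Lemma run_steps w P tape s k : deterministic P -> run w P tape s k = steps w P k s.
Proof.
move=> dP; elim: k => //= k ->; rewrite /steps /=.
case: (iter k _ s) => p r m; move: dP; rewrite /step /fetch /=; have [pP|pP] := ltnP p (size P).
  by move/all_nthP=> /(_ Halt p pP); case: (nth Halt P p).
by rewrite [nth _ _ _]nth_default.
Qed.

Lemma steps_halted w P s k j : halted P (steps w P k s) -> k <= j ->
  steps w P j s = steps w P k s.
Proof.
move=> h kj; rewrite -(subnKC kj) steps_add; elim: (j - k) => // i IH.
rewrite -addn1 steps_add IH; move: h.
by rewrite /halted; case: (steps w P k s) => p r m; rewrite /steps /= /step; case: fetch.
Qed.

Lemma sum_ltn_leq K k0 : \sum_(k < K) (k < k0) <= k0.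
Proof.
suff : \sum_(k < K) (k < k0) <= minn K k0 by rewrite leq_min => /andP[].
elim: K => [|K IH]; first by rewrite big_ord0.
by rewrite big_ord_recr /=; move: IH; case: (ltnP K k0) => h /=; lia.
Qed.

Lemma reconstruction_program : exists (P : program) (C : nat), deterministic P /\
  forall (w : nat) (G : sgraph) (label : G -> 'I_(2 ^ w)) (ts : seq (G * G * G)),
    connected_graph G -> triangle_free G -> 5 <= #|G| -> injective label ->
    lists_triples ts -> 240 * #|connected_triples G| <= 2 ^ w ->
    exists k, let s := steps w P k (init_state label ts) in
      [/\ k <= C * #|connected_triples G|, halted P s & outputs_edges label s].
Proof.
exists (compile 0 reconstruction), (41 * 100); split; first by vm_compute.
move=> w G label ts conn tfree card5 linj tsP wT; rewrite -(size_ts tsP) in wT *.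
have xsw x : x \in input_labels label ts -> x < 2 ^ w.
  by case/mapP=> v _ ->; apply: ltn_ord.
have := reconstruction_correct (T_gt1 conn card5 tsP) wT (size_input_labels label ts) xsw.
move: reconstruction => cs /(_ (compile 0 cs) [::] [::] (fun=> 0) (fun=> 0)).
move=> /(_ (fun i => nth 0 (triples_words label ts) i)).
rewrite cats0 triples_wordsE => /(_ erefl (fun _ _ => erefl) (fun _ => erefl)).
case=> k [r2 [r2' [m2 [kT e _ q]]]]; exists k; rewrite /init_state triples_wordsE.
rewrite e; split; first exact: kT.
  (* The program halts by running off its end, where [fetch] defaults to [Halt]. *)
  by rewrite /halted /fetch nth_default.
exact: (@reconstructed_outputs w G label ts).
Qed.

Theorem theorem2 :
  (exists (P : program) (c C : nat),
     deterministic P /\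
     forall (w : nat) (G : sgraph) (label : G -> 'I_(2 ^ w))
            (ts : seq (G * G * G)) (tape : nat -> 'I_(2 ^ w)),
       connected_graph G -> triangle_free G -> 5 <= #|G| ->
       injective label -> lists_triples ts ->
       c * #|connected_triples G| <= 2 ^ w ->
       exists k : nat,
         [/\ k <= C * (#|connected_triples G|
                       * trunc_log 2 #|connected_triples G|),
             halted P (run w P tape (init_state label ts) k)
           & outputs_edges label (run w P tape (init_state label ts) k)])
  /\
  (exists (P : program) (c C : nat),
     forall (w : nat) (G : sgraph) (label : G -> 'I_(2 ^ w))
            (ts : seq (G * G * G)),
       connected_graph G -> triangle_free G -> 5 <= #|G| ->
       injective label -> lists_triples ts ->
       c * #|connected_triples G| <= 2 ^ w ->
       expected_time_le w P (init_state label ts) (C * #|connected_triples G|)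
       /\
       forall (tape : nat -> 'I_(2 ^ w)) (k : nat),
         halted P (run w P tape (init_state label ts) k) ->
         outputs_edges label (run w P tape (init_state label ts) k)).
Proof.
have [P [C [dP correct]]] := reconstruction_program.
split; exists P, 240, C.
  split=> // w G label ts tape conn tfree card5 linj tsP wT.
  have [k [kT hk ok]] := correct w G label ts conn tfree card5 linj tsP wT.
  exists k; rewrite run_steps //; split=> //; apply: leq_trans kT _.
  (* A linear bound suffices because the logarithm is at least 1. *)
  rewrite leq_mul2l leq_pmulr ?orbT // trunc_log_gt0.
  by rewrite card_connected_triples_gt1.
move=> w G label ts conn tfree card5 linj tsP wT.
have [k0 [kT hk ok]] := correct w G label ts conn tfree card5 linj tsP wT.
split=> [K|tape k].
  rewrite /mean_time_upto.
  (* The bound holds for every tape, hence for the mean. *)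
  have le (u : K.-tuple 'I_(2 ^ w)) : time_upto w P
      (fun i => nth 0 (map val u) i) (init_state label ts) K
      <= C * #|connected_triples G|.
    apply: leq_trans kT; apply: (@leq_trans (\sum_(k < K) (k < k0))).
      apply: leq_sum => k _; rewrite run_steps //; case: (ltnP k k0) => [_|kk].
        exact: leq_b1.
      by rewrite (steps_halted hk kk) hk.
    exact: sum_ltn_leq.
  rewrite Num.Theory.ler_pdivrMr; last first.
    by rewrite Num.Theory.ltr0n expn_gt0 expn_gt0.
  rewrite -GRing.natrM -GRing.natr_sum Num.Theory.ler_nat.
  apply: leq_trans (leq_sum _ (fun u _ => le u)) _.
  by rewrite sum_nat_const card_tuple card_ord mulnC.
(* Halted states are fixed, so any halted state is the one reached after [k0] steps. *)
rewrite run_steps // => h; have [kk|kk] := leqP k0 k.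
  by rewrite (steps_halted hk kk).
by rewrite -(steps_halted h (ltnW kk)).
Qed.
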